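(* Let $p$ be a prime, $F$ a field of characteristic $p$, and suppose $G=G_+$. Let $L$ be a free color Lie $p$-algebra over $F$ freely generated by $X=\{x_1,\dots,x_r\}$. Then for every $n\ge1$ and every $\alpha=(\alpha_1,\dots,\alpha_r)\in\mathbb{N}_0^r\setminus\{0\}$, $$\dim L_n=\frac1n\sum_{m\mid n}\mu_p(m)\,r^{\frac nm},$$ $$\dim L_\alpha=\frac1{|\alpha|}\sum_{m\mid\alpha}\mu_p(m)\,\frac{(|\alpha|/m)!}{(\alpha_1/m)!\cdots(\alpha_r/m)!}.$$
   Context: $\mathbb{N}_0=\{0,1,2,\dots\}$; $\mu$ is the Möbius function. Define $\mu_p(n)=\mu(n)$ if $p\nmid n$, and $\mu_p(n)=\mu(m)(p^s-p^{s-1})$ if $n=mp^s$ with $p\nmid m$, $s\ge1$. Color Lie $p$-algebras: $G$ is an abelian group (written multiplicatively), $\gamma:G\times G\to F^{\times}$ a bicharacter with $\gamma(g,h)\gamma(h,g)=1$; $G_+=\{g:\gamma(g,g)=1\}$, here $G=G_+$. A color Lie algebra is a $G$-graded space $L=\bigoplus_gL_g$ with bilinear bracket, $[L_g,L_h]\subseteq L_{gh}$, such that for $x\in L_g,y\in L_h,z\in L$: $[x,y]=-\gamma(g,h)[y,x]$, $[x,[y,z]]=[[x,y],z]+\gamma(g,h)[y,[x,z]]$, and $[x,x]=0$. It is a color Lie $p$-algebra if for each $g\in G$ there is a map $L_g\to L_{g^p}$, $x\mapsto x^{[p]}$, with $(ax)^{[p]}=a^px^{[p]}$ ($a\in F$),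 $[x^{[p]},z]=(\mathrm{ad}\,x)^p(z)$ for all $z\in L$, and $(x+y)^{[p]}=x^{[p]}+y^{[p]}+\sum_{i=1}^{p-1}s_i(x,y)$ for $x,y\in L_g$, where $i\,s_i(x,y)$ is the coefficient of $t^{i-1}$ in $(\mathrm{ad}(tx+y))^{p-1}(x)$. The free color Lie $p$-algebra on a $G$-graded set $X$ (each $x_i$ has some $G$-degree) is defined by the usual universal property for $G$-degree-preserving maps. $L$ is $\mathbb{N}_0^r$-graded by multidegree in $x_1,\dots,x_r$ ($x_i$ has multidegree the $i$th unit vector, brackets add multidegrees, the $p$-map multiplies the multidegree by $p$); $L_\alpha$ is the component of multidegree $\alpha$, $|\alpha|=\alpha_1+\cdots+\alpha_r$, and $L_n=\bigoplus_{|\alpha|=n}L_\alpha$. The notation $m\mid\alpha$ means that the positive integer $m$ divides every $\alpha_i$. *)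

(* Defs.v *)
(* MathComp and Multinomials. The grading group [G], written multiplicatively
   in the literature, is a [zmodType] and hence written additively: the degrees
   gh and g^p are [g + h] and [g *+ p]. *)
From HB Require Import structures.
From mathcomp Require Export all_boot all_order all_algebra.
From mathcomp.multinomials Require Export mpoly.

Set Implicit Arguments.
Unset Strict Implicit.
Unset Printing Implicit Defensive.

Import GRing.Theory.
Local Open Scope ring_scope.

(* Only meaningful for [0 < n]. *)
Definition moebius (n : nat) : int :=
  if all (fun q => logn q n == 1%N) (primes n) then (-1) ^+ size (primes n)
  else 0.

(* [n`_p^'] is the m, and [logn p n] the s, of the factorization n = m p^s with
   p not dividing m. *)
Definition moebius_p (p n : nat) : int :=
  if (p %| n)%N then
    moebius n`_p^' * ((p ^ logn p n)%:Z - (p ^ (logn p n).-1)%:Z)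
  else moebius n.

Section LinearAlgebra.
Variables (F : fieldType) (V : lmodType F).

Definition subspace (W : V -> Prop) : Prop :=
  W 0 /\ forall (a : F) u v, W u -> W v -> W (a *: u + v).

Definition has_dim (W : V -> Prop) (d : nat) : Prop :=
  exists b : 'I_d -> V,
    [/\ forall i, W (b i),
        forall c : 'I_d -> F, \sum_i c i *: b i = 0 -> forall i, c i = 0
      & forall v, W v -> exists c : 'I_d -> F, v = \sum_i c i *: b i].

(* V is the direct sum of the [W g]. *)
Record grading (G : zmodType) (W : G -> V -> Prop) : Prop := Grading {
  grading_subspace : forall g, subspace (W g);
  grading_span : forall v, exists (s : seq G) (f : G -> V),
    (forall g, W g (f g)) /\ v = \sum_(g <- s) f g;
  grading_indep : forall (s : seq G) (f : G -> V), uniq s ->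
    (forall g, W g (f g)) -> \sum_(g <- s) f g = 0 ->
    forall g, g \in s -> f g = 0
}.

End LinearAlgebra.

Section ColorLie.
Variables (F : fieldType) (p : nat) (G : zmodType) (gamma : G -> G -> F).

Record color_bicharacter : Prop := ColorBicharacter {
  bichar_neq0 : forall g h, gamma g h != 0;
  bicharDl : forall g h k, gamma (g + h) k = gamma g k * gamma h k;
  bicharDr : forall g h k, gamma g (h + k) = gamma g h * gamma g k;
  bichar_sym : forall g h, gamma g h * gamma h g = 1
}.

(* The subgroup G_+ of G. *)
Definition Gplus (g : G) : Prop := gamma g g = 1.

(* The notion appropriate to G = G_+: the alternating law is imposed in every
   degree. *)
Record colorLieAlg := ColorLieAlg {
  carrier :> lmodType F;
  comp : G -> carrier -> Prop;
  bracket : carrier -> carrier -> carrier;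
  comp_grading : grading comp;
  bracket_linearr : forall x, linear (bracket x);
  bracket_linearl : forall y, linear (bracket^~ y);
  bracket_comp : forall g h x y,
    comp g x -> comp h y -> comp (g + h) (bracket x y);
  bracket_skew : forall g h x y, comp g x -> comp h y ->
    bracket x y = - (gamma g h *: bracket y x);
  bracket_jacobi : forall g h x y z, comp g x -> comp h y ->
    bracket x (bracket y z) =
      bracket (bracket x y) z + gamma g h *: bracket y (bracket x z);
  bracket_alt : forall g x, comp g x -> bracket x x = 0
}.

(* An element of L[t] is represented by its sequence of coefficients
   [nat -> L]; the bracket of L is extended F[t]-bilinearly. *)
Definition tbracket (L : colorLieAlg) (u v : nat -> L) : nat -> L :=
  fun k => \sum_(i < k.+1) bracket (u i) (v (k - i)%N).

(* i s_i(x, y) is the coefficient of t^(i-1) in (ad (tx + y))^(p-1) (x). *)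
Definition jacobson_s (L : colorLieAlg) (i : nat) (x y : L) : L :=
  (i%:R : F)^-1 *:
    iter p.-1 (tbracket (fun k => [:: y; x]`_k)) (fun k => [:: x]`_k) i.-1.

(* For each g, only the values of [pmap g] on [comp g] are relevant. *)
Record colorLiePAlg := ColorLiePAlg {
  color_lie :> colorLieAlg;
  pmap : G -> color_lie -> color_lie;
  pmap_comp : forall g x, comp g x -> comp (g *+ p) (pmap g x);
  pmapZ : forall g (a : F) x, comp g x -> pmap g (a *: x) = a ^+ p *: pmap g x;
  pmap_ad : forall g x z, comp g x ->
    bracket (pmap g x) z = iter p (bracket x) z;
  pmapD : forall g x y, comp g x -> comp g y ->
    pmap g (x + y) = pmap g x + pmap g y + \sum_(1 <= i < p) jacobson_s i x y
}.

Record color_hom (L M : colorLiePAlg) (phi : {linear L -> M}) : Prop :=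
  ColorHom {
    hom_comp : forall g x, comp g x -> comp g (phi x);
    hom_bracket : forall x y, phi (bracket x y) = bracket (phi x) (phi y);
    hom_pmap : forall g x, comp g x -> phi (pmap g x) = pmap g (phi x)
}.

Section Free.
Variables (r : nat) (deg : 'I_r -> G) (L : colorLiePAlg) (x : 'I_r -> L).

(* L is free on x_1, ..., x_r, where x_i has G-degree [deg i]. *)
Record free_on : Prop := FreeOn {
  free_deg : forall i, comp (deg i) (x i);
  free_lift : forall (M : colorLiePAlg) (y : 'I_r -> M),
    (forall i, comp (deg i) (y i)) ->
    exists2 phi : {linear L -> M}, color_hom phi & forall i, phi (x i) = y i;
  free_uniq : forall (M : colorLiePAlg) (phi psi : {linear L -> M}),
    color_hom phi -> color_hom psi -> (forall i, phi (x i) = psi (x i)) ->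
    phi =1 psi
}.

(* [mdcomp alpha] is L_alpha: the smallest family of subspaces with x_i in
   degree the i-th unit vector, for which brackets add multidegrees and the
   p-map multiplies them by p. *)
Inductive mdcomp : 'X_{1..r} -> L -> Prop :=
| Mdcomp_gen i : mdcomp U_(i)%MM (x i)
| Mdcomp_0 alpha : mdcomp alpha 0
| Mdcomp_lin alpha (a : F) u v :
    mdcomp alpha u -> mdcomp alpha v -> mdcomp alpha (a *: u + v)
| Mdcomp_bracket alpha beta u v :
    mdcomp alpha u -> mdcomp beta v -> mdcomp (alpha + beta)%MM (bracket u v)
| Mdcomp_pmap alpha g u :
    mdcomp alpha u -> comp g u -> mdcomp (alpha *+ p)%MM (pmap g u).

(* L_n, the sum of the L_alpha with |alpha| = n; ['X_{1..r < n.+1}] is the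
   finite type of the multi-indices alpha with |alpha| <= n. *)
Definition totcomp (n : nat) (v : L) : Prop :=
  exists u : 'X_{1..r} -> L, (forall alpha, mdcomp alpha (u alpha)) /\
    v = \sum_(alpha : 'X_{1..r < n.+1} | mdeg alpha == n) u alpha.

End Free.
End ColorLie.

(* Main.v *)
Require Import Defs.
From mathcomp Require Import all_boot all_order all_algebra.
From mathcomp.multinomials Require Import mpoly.
From HB Require Import structures.
From mathcomp Require Import finmap ring.
From mathcomp.multinomials Require monalg.

Import GRing.Theory.
Local Open Scope ring_scope.

(** Order words lexicographically. A Lyndon word is smaller than its proper
    suffixes; split before its least proper suffix, it is a product of two
    shorter Lyndon words, so that it carries a standard bracketing. The p^k-th
    powers of the standard brackets, evaluated at the generators, form a
    homogeneous basis of L.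

    - They span. By the Jacobi identity and the (color) antisymmetry, a bracket
      of two standard brackets is a combination of standard brackets
      ([straighten]); brackets of p-th powers reduce to iterated brackets since
      ad(u^[p]) = (ad u)^p, and p-th powers of sums are governed by the
      additivity of the p-map up to brackets. Hence [mdcomp_pspan].

    - They are linearly independent. The free associative algebra, with the
      color commutator and the p-th power, is a color Lie p-algebra
      ([falg_plie]); Jacobson's formula ([jacobson_formula]) is needed here.
      Freeness of L maps the generators to the letters, and a standard bracket
      with Lyndon word l to l plus greater words, because uv < vu for Lyndon
      words u < v. So its p^k-th power is mapped to l^(p^k) plus greater words,
      and these least words are distinct ([has_dim_pidx]). Embedding L in an
      enveloping algebra is not needed.

    It remains to count the words of length n, in all or of multidegree alpha,
    that are p^k-th powers of Lyndon words. If a word v has n / N distinct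
    rotations, then it is an N-th power, and it is an m-th power exactly for m
    dividing N. Its rotation class contains exactly one power of a Lyndon word,
    namely its least element ([card_least_rot]). As the sum of mu_p(m) over the
    divisors m of N is N if N is a power of p and 0 otherwise
    ([sum_moebius_p]), n times the number sought is the sum over m dividing n of
    mu_p(m) times the number of m-th powers ([card_pidx]); these number
    r^(n/m), respectively a multinomial coefficient. *)

Set Implicit Arguments.
Unset Strict Implicit.
Unset Printing Implicit Defensive.

(* The unqualified names denote function composition and the partial map on
   sequences. *)
Local Notation comp := Defs.comp.
Local Notation pmap := Defs.pmap.

(** * Lexicographic order, Lyndon words and standard bracketings *)

Section Words.
Import Order.TTheory Order.DefaultSeqLexiOrder.
Local Open Scope order_scope.
Context {disp : Order.disp_t} {T : orderType disp}.
Implicit Types u v w a b c s : seq T.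

Lemma lt_cat2l w u v : (w ++ u < w ++ v) = (u < v).
Proof. by elim: w => //= x w IH; rewrite eqhead_ltxiE. Qed.

Lemma le_cat2l w u v : (w ++ u <= w ++ v) = (u <= v).
Proof. by rewrite !le_eqVlt lt_cat2l eqseq_cat // eqxx. Qed.

Lemma le_catr u v : u <= u ++ v.
Proof. by rewrite -[X in X <= _]cats0 le_cat2l lexi0s. Qed.

Lemma lt_ext u v a b : u < v -> ~~ prefix u v -> u ++ a < v ++ b.
Proof.
elim: u v => [|x u IH] [|y v] //=.
rewrite !ltxi_cons; case: (ltgtP x y) => //= _; exact: IH.
Qed.

Lemma lt_cat_size u v a b : size u = size v -> u < v -> u ++ a < v ++ b.
Proof.
move=> suv uv; apply: lt_ext => //; apply/prefixP => -[c ev].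
move: uv; rewrite ev; move/(congr1 size): ev; rewrite size_cat suv => /eqP.
by rewrite -{1}[size v]addn0 eqn_add2l eq_sym => /nilP ->; rewrite cats0 ltxx.
Qed.

Lemma le_cat_size u v a : size u = size v -> u <= v -> u ++ a <= v ++ a.
Proof.
move=> suv; rewrite le_eqVlt => /orP[/eqP->//|uv].
exact/ltW/lt_cat_size.
Qed.

Lemma cat_eq_cat u v a s : u ++ v = a ++ s ->
  (exists c, a = u ++ c /\ v = c ++ s) \/
  (exists c, c <> [::] /\ u = a ++ c /\ s = c ++ v).
Proof.
elim: u a => [|x u IH] [|y a] /=.
- by move=> ->; left; exists [::].
- by move=> ->; left; exists (y :: a).
- by move=> <-; right; exists (x :: u).
case=> <- /IH[[c [-> ->]]|[c [c0 [-> ->]]]]; first by left; exists c.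
by right; exists c.
Qed.

(** A nonempty word is a Lyndon word if it is smaller than each of its proper
    nonempty suffixes. *)
Definition lyndon w :=
  w <> [::] /\ forall u v, w = u ++ v -> u <> [::] -> v <> [::] -> w < v.

Lemma lyndon_cat_lt u v : lyndon u -> lyndon v -> u < v -> u ++ v < v.
Proof.
move=> [u0 lu] [v0 lv] uv; case: (boolP (prefix u v)) => [/prefixP[c ev]|np].
  rewrite [X in _ < X]ev lt_cat2l; apply: (lv _ _ ev u0) => c0.
  by move: uv; rewrite ev c0 cats0 ltxx.
by rewrite -[X in _ < X]cats0; apply: lt_ext.
Qed.

Lemma proper_suffix_nprefix u a c : a <> [::] -> u = a ++ c -> ~~ prefix u c.
Proof.
move=> a0 eu; apply/prefixP => -[b /(congr1 size)]; rewrite eu !size_cat.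
case: a a0 {eu} => //= x a _ /eqP.
by rewrite -addnA addnCA addSn -addnS -{1}[size c]addn0 eqn_add2l addnS.
Qed.

Lemma lyndon_cat u v : lyndon u -> lyndon v -> u < v -> lyndon (u ++ v).
Proof.
move=> hu hv uv; have ltv := lyndon_cat_lt hu hv uv.
case: hu hv => u0 lu [v0 lv]; split; first by case: (u) u0.
move=> a s eas a0 s0; case: (cat_eq_cat eas) => [[c [ea ev]]|[c [c0 [ea es]]]].
  case: c ea ev => [|x c] ea /= ev; first by rewrite -ev.
  by apply: lt_trans ltv (lv (x :: c) s ev _ s0).
rewrite es; apply: lt_ext; first exact: lu ea a0 c0.
exact: proper_suffix_nprefix ea.
Qed.

Lemma lyndon_swap u v : lyndon u -> lyndon v -> u < v -> u ++ v < v ++ u.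
Proof.
by move=> lu lv uv; apply: lt_le_trans (lyndon_cat_lt lu lv uv) (le_catr _ _).
Qed.

(** Nonassociative words, that is, bracket arrangements of words. *)
Inductive tree := Leaf of T | Node of tree & tree.

(** The word obtained by forgetting the brackets. *)
Fixpoint fw t := match t with Leaf x => [:: x] | Node a b => fw a ++ fw b end.

(** The standard bracketings of Lyndon words: a word is split before its
    least proper suffix. The last clause, which compares the right factor of
    the left factor with the right factor, expresses this locally, without
    reference to all the suffixes. *)
Fixpoint std t := match t with
  | Leaf _ => true
  | Node t1 t2 => [&& std t1, std t2, fw t1 < fw t2 &
                      if t1 is Node _ b then fw t2 <= fw b else true]
  end.

Lemma fw_neq0 t : fw t <> [::].
Proof. by elim: t => //= a IH b _; case: (fw a) IH. Qed.

Lemma std_lyndon t : std t -> lyndon (fw t).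
Proof.
elim: t => [x _|a IHa b IHb /= /and4P[/IHa la /IHb lb ab _]].
  split=> // -[//|y [|//]] v [_ /=]; by move=> <-.
exact: lyndon_cat.
Qed.

(** The local condition in [std] says that the right factor is the least proper
    suffix, which is why a word has at most one standard bracketing. *)
Lemma std_least t1 t2 a s : std (Node t1 t2) -> fw t1 ++ fw t2 = a ++ s ->
  a <> [::] -> s <> [::] -> fw t2 <= s.
Proof.
elim: t1 t2 a s => [x|t11 IH t12 _] t2 a s std12 eas a0 s0;
  have /andP[st1 /andP[st2 /andP[t12lt cond]]] := std12;
  have [_ lt2] := std_lyndon st2;
  case: (cat_eq_cat eas) => [[c [ea ev]]|[c [c0 [ea es]]]].
- by case: c ea ev => [|y c] ea ev; [rewrite ev | apply/ltW/(lt2 _ _ ev)].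
- case: a a0 ea {eas} => // y [|//] _ /= [_ ec]; by case: c0.
- by case: c ea ev => [|y c] ea ev; [rewrite ev | apply/ltW/(lt2 _ _ ev)].
- rewrite es; apply: le_trans (le_catr _ _); apply: le_trans cond _.
  exact: (IH _ _ _ st1 ea).
Qed.

Lemma fw_inj t t' : std t -> std t' -> fw t = fw t' -> t = t'.
Proof.
have one (x : T) (a b : tree) : [:: x] <> fw a ++ fw b.
  move/(congr1 size); rewrite size_cat /=.
  by case: (fw a) (@fw_neq0 a) => // ? ?; case: (fw b) (@fw_neq0 b) => //= ? ?;
     rewrite addnS.
elim: t t' => [x|a IHa b IHb] [y|a' b'] st st' /=; first by case=> ->.
- by move/one.
- by move/esym/one.
move=> e; have eb : fw b = fw b'.
  apply/le_anti; rewrite (std_least st e) ?(std_least st' (esym e)) //;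
  exact: fw_neq0.
have ea : fw a = fw a'.
  move/eqP: (e); rewrite eqseq_cat ?eb; first by case/andP => /eqP.
  by move/(congr1 size): e; rewrite !size_cat eb => /addIn.
case/and4P: st st' => sa sb _ _ /and4P[sa' sb' _ _].
by rewrite (IHa a') // (IHb b').
Qed.

Lemma least_suffix w : (1 < size w)%N -> exists u v,
  [/\ w = u ++ v, u <> [::], v <> [::] & forall a s, w = a ++ s -> a <> [::] ->
      s <> [::] -> v <= s].
Proof.
move=> w1; pose i0 := Ordinal w1.
pose P (i : 'I_(size w)) := (0 < i)%N.
have P0 : P i0 by [].
case: (@arg_minP _ _ _ i0 P (fun i : 'I__ => drop i w) P0) => i Pi imin.
exists (take i w), (drop i w); split; first by rewrite cat_take_drop.
- move=> /(congr1 size); rewrite size_takel ?(ltnW (ltn_ord i)) // => i00.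
  by move: Pi; rewrite /P i00.
- by move=> /(congr1 size)/eqP; rewrite size_drop subn_eq0 leqNgt ltn_ord.
move=> a s ew a0 s0.
have sa : (size a < size w)%N.
  by rewrite ew size_cat -{1}[size a]addn0 ltn_add2l; case: (s) s0.
have <- : drop (size a) w = s by rewrite ew drop_size_cat.
by apply: (imin (Ordinal sa)); rewrite /P /=; case: (a) a0.
Qed.

Lemma lyndon_std w : lyndon w -> exists2 t, std t & fw t = w.
Proof.
have [n] := ubnP (size w); elim: n w => // n IH w; rewrite ltnS => wn lw.
have [w0 hw] := lw.
case: (leqP (size w) 1) => [|w1].
  by case: (w) w0 => // x [|//] _ _; exists (Leaf x).
have [u [v [ew u0 v0 vmin]]] := least_suffix w1.
have uvlt : w < v by apply: hw ew u0 v0.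
have [su sv] : (size u < n)%N /\ (size v < n)%N.
  split; apply: leq_trans wn; rewrite ew size_cat.
    by rewrite -addn1 leq_add2l; case: (v) v0.
  by rewrite -add1n leq_add2r; case: (u) u0.
have lv : lyndon v.
  split=> // a s ev a0 s0; have /vmin : w = (u ++ a) ++ s by rewrite -catA -ev.
  rewrite le_eqVlt => /(_ _ s0)/orP[||//]; first by case: (u) u0.
  move/eqP => vs; move: (congr1 size ev); rewrite vs size_cat => /eqP.
  by rewrite -{1}[size s]add0n eqn_add2r; case: (a) a0.
have ulw : u <= w by rewrite ew le_catr.
(* If a proper suffix [s] of [u] were smaller than [u], then [s] would be a
   prefix of [u], say [u = s ++ c], and [c ++ v] would be a proper suffix of [w]
   smaller than [v]. *)
have lu : lyndon u.
  split=> // a s eu a0 s0.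
  have ws : w = a ++ (s ++ v) by rewrite catA -eu.
  have sv0 : s ++ v <> [::] by case: (s) s0.
  have uvs := hw _ _ ws a0 sv0.
  case: (ltgtP u s) => // [su'|eus]; last first.
    move: (congr1 size eu); rewrite eus size_cat => /eqP.
    by rewrite -{1}[size s]add0n eqn_add2r; case: (a) a0.
  case: (boolP (prefix s u)) => [/prefixP[c eu']|np]; last first.
    by have := lt_ext v v su' np; rewrite -ew ltNge (ltW uvs).
  have : v <= c ++ v.
    apply: (vmin s); rewrite ?catA -?eu' //.
    by case: (c).
  by rewrite leNgt; move: uvs; rewrite ew {1}eu' -catA lt_cat2l => ->.
have ltuv : u < v by apply: le_lt_trans ulw uvlt.
have [t1 st1 et1] := IH u su lu; have [t2 st2 et2] := IH v sv lv.
exists (Node t1 t2); rewrite /= ?et1 ?et2 // st1 st2 ltuv /=.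
case: t1 et1 st1 => // a b /= eab _.
have b0 := @fw_neq0 b.
have : v <= fw b ++ v.
  apply: (vmin (fw a)) (@fw_neq0 a) _; first by rewrite catA eab.
  by case: (fw b) b0.
case: (leP v (fw b)) => // bv vb.
case: (boolP (prefix (fw b) v)) => [/prefixP[c ev]|np]; last first.
  by have := lt_ext v [::] bv np; rewrite cats0 ltNge vb.
have [_ lv'] := lv.
have c0 : c <> [::] by move=> c0; move: bv; rewrite ev c0 cats0 ltxx.
by have := lv' _ _ ev b0 c0; rewrite ltNge -(le_cat2l (fw b)) -ev vb.
Qed.

Lemma lyndon_rotate u v :
  lyndon (u ++ v) -> u <> [::] -> v <> [::] -> u ++ v < v ++ u.
Proof.
by move=> [_ h] u0 v0; apply: lt_le_trans (h _ _ erefl u0 v0) (le_catr _ _).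
Qed.

(** A word smaller than all its proper rotations is Lyndon. *)
Lemma rotate_lyndon w : w <> [::] ->
  (forall u v, w = u ++ v -> u <> [::] -> v <> [::] -> w < v ++ u) -> lyndon w.
Proof.
move=> w0 h; split=> // u v ew u0 v0; have hvu := h _ _ ew u0 v0.
case: (ltgtP w v) => // [vw|ewv]; last first.
  move: (congr1 size ew); rewrite ewv size_cat => /eqP.
  by rewrite -{1}[size v]add0n eqn_add2r; case: (u) u0.
case: (boolP (prefix v w)) => [/prefixP[c ew']|np]; last first.
  by have := lt_ext u [::] vw np; rewrite cats0 ltNge (ltW hvu).
have suc : size c = size u.
  move: (congr1 size ew'); rewrite ew !size_cat addnC => /eqP.
  by rewrite eqn_add2l => /eqP.
have cu : c < u by move: hvu; rewrite ew' lt_cat2l.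
have c0 : c <> [::] by move=> c0; move: suc; rewrite c0; case: (u) u0.
have := h _ _ ew' v0 c0; rewrite ew ltNge.
by rewrite (ltW (lt_cat_size _ _ suc cu)).
Qed.

End Words.
Arguments Leaf {disp T} _.
Arguments Node {disp T} _ _.

(** * Powers, rotations and periods of words *)

Section Periods.
Import Order.TTheory Order.DefaultSeqLexiOrder.
Local Open Scope order_scope.
Context {disp : Order.disp_t} {T : orderType disp}.
Implicit Types u v w a b c s l : seq T.

(** The N-th power of a word. *)
Definition wpow w N := flatten (nseq N w).

Lemma wpowS w N : wpow w N.+1 = w ++ wpow w N.
Proof. by []. Qed.

Lemma size_wpow w N : size (wpow w N) = (N * size w)%N.
Proof. by elim: N => //= N IH; rewrite size_cat IH mulSn. Qed.

Lemma wpow_shift a b N : a ++ wpow (b ++ a) N = wpow (a ++ b) N ++ a.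
Proof.
elim: N => [|N IH]; first by rewrite /= cats0.
by rewrite !wpowS -!catA IH.
Qed.

Lemma rot_wpow a b N : rot (size a) (wpow (a ++ b) N) = wpow (b ++ a) N.
Proof.
case: N => [|N]; first by case: (size a).
by rewrite !wpowS -catA rot_size_cat -!catA -wpow_shift.
Qed.

Lemma wpow_commuting a b q :
  a ++ b = b ++ a -> size b = (q * size a)%N -> b = wpow a q.
Proof.
elim: q b => [|q IH] b ab; first by move/eqP/nilP.
rewrite mulSn => sb.
have eb : b = a ++ drop (size a) b.
  rewrite -{1}(cat_take_drop (size a) b); congr (_ ++ _).
  have := congr1 (take (size a)) ab; rewrite take_size_cat // takel_cat => [<- //|].
  by rewrite sb leq_addr.
rewrite eb wpowS; congr (_ ++ _); apply: IH.
  by move/eqP: ab; rewrite {1 2}eb -catA eqseq_cat // eqxx => /eqP.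
by rewrite size_drop sb addKn.
Qed.

Lemma per_ex v : exists d, (0 < d)%N && (rot d v == v).
Proof. by exists (size v).+1; rewrite rot_oversize //=. Qed.

(** The least positive period of a word for rotation. *)
Definition per v := ex_minn (per_ex v).

Lemma per_gt0 v : (0 < per v)%N.
Proof. by rewrite /per; case: ex_minnP => d /andP[]. Qed.

Lemma rot_per v : rot (per v) v = v.
Proof. by rewrite /per; case: ex_minnP => d /andP[_ /eqP]. Qed.

Lemma per_min v d : (0 < d)%N -> rot d v = v -> (per v <= d)%N.
Proof.
by move=> d0 dv; rewrite /per; case: ex_minnP => e _; apply; rewrite d0 dv /=.
Qed.

Lemma rot_mul_per v q : (q * per v <= size v)%N -> rot (q * per v) v = v.
Proof.
elim: q => [|q IH]; first by rewrite rot0.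
by rewrite mulSn => h; rewrite rotD // IH ?rot_per // (leq_trans _ h) ?leq_addl.
Qed.

Lemma per_dvdP v i : (i <= size v)%N -> (rot i v == v) = (per v %| i)%N.
Proof.
move=> iv; apply/eqP/idP => [|/dvdnP[q eq]]; last first.
  by rewrite eq rot_mul_per -?eq.
rewrite {1}(divn_eq i (per v)) addnC rotD; last by rewrite addnC -divn_eq.
rewrite rot_mul_per; last by apply: leq_trans iv; exact: leq_trunc_div.
rewrite /dvdn; case: posnP => [->//|r0] /(per_min r0).
by rewrite leqNgt ltn_mod per_gt0.
Qed.

Lemma per_dvd_size v : (per v %| size v)%N.
Proof. by rewrite -per_dvdP ?rot_size. Qed.

Lemma wpow_rot v k : (k %| size v)%N -> rot k v = v ->
  v = wpow (take k v) (size v %/ k).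
Proof.
have [->|v0] := eqVneq v [::]; first by rewrite div0n.
have sv0 : (0 < size v)%N by rewrite lt0n size_eq0.
move=> kv vk; have k0 : (0 < k)%N by apply: dvdn_gt0 kv.
have kle : (k <= size v)%N by apply: dvdn_leq kv.
have sq : (0 < size v %/ k)%N by rewrite divn_gt0.
rewrite -{1}(cat_take_drop k v) -(prednK sq) wpowS; congr (_ ++ _).
apply: wpow_commuting; first by rewrite cat_take_drop -[LHS]vk.
by rewrite size_drop size_takel // -subn1 mulnBl mul1n divnK.
Qed.

Lemma wpow_per v : v = wpow (take (per v) v) (size v %/ per v).
Proof. by apply: wpow_rot; rewrite ?per_dvd_size ?rot_per. Qed.

Lemma lyndon_per l N : lyndon l -> (0 < N)%N -> per (wpow l N) = size l.
Proof.
move=> ll N0; have [l0 _] := ll; set v := wpow l N.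
have lv : (size l <= size v)%N by rewrite size_wpow leq_pmull.
have sl0 : (0 < size l)%N by rewrite lt0n size_eq0; apply/eqP.
have pl : (per v %| size l)%N.
  by rewrite -per_dvdP // /v; have := rot_wpow l [::] N; rewrite cats0 => ->.
apply/eqP; rewrite eqn_leq (dvdn_leq sl0 pl) leqNgt; apply/negP => lt.
set a := take (per v) l; set b := drop (per v) l.
have sa : size a = per v by rewrite size_takel // ltnW.
have el : a ++ b = l by apply: cat_take_drop.
have a0 : a <> [::] by move=> a0; move: (per_gt0 v); rewrite -sa a0.
have b0 : b <> [::] by move=> b0; move: lt; rewrite -el b0 cats0 sa ltnn.
have : wpow (b ++ a) N = wpow (a ++ b) N by rewrite -rot_wpow sa el rot_per.
have -> : N = N.-1.+1 by rewrite prednK.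
move=> /eqP; rewrite !wpowS eqseq_cat ?size_cat 1?addnC // => /andP[/eqP eba _].
by rewrite -el in ll; have := lyndon_rotate ll a0 b0; rewrite eba ltxx.
Qed.

Lemma lyndon_pow_inj l l' N N' : lyndon l -> lyndon l' -> (0 < N)%N ->
  (0 < N')%N -> wpow l N = wpow l' N' -> l = l' /\ N = N'.
Proof.
move=> ll ll' N0 N0' e.
have es : size l = size l' by rewrite -(lyndon_per ll N0) e lyndon_per.
have sl0 : (0 < size l)%N by case: ll => /eqP; rewrite -size_eq0 lt0n.
have eN : N = N'.
  by move/(congr1 size)/eqP: e; rewrite !size_wpow -es eqn_pmul2r // => /eqP.
split=> //; move: e; rewrite -eN -(prednK N0) !wpowS => /eqP.
by rewrite eqseq_cat // => /andP[/eqP].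
Qed.

Lemma lyndon_pow_least l N i : lyndon l -> wpow l N <= rot i (wpow l N).
Proof.
case: N => [|N] ll; first by rewrite lexi0s.
set v := wpow l N.+1; have pv : per v = size l by apply: lyndon_per.
case: (leqP i (size v)) => [iv|/ltnW iv]; last by rewrite rot_oversize.
rewrite (divn_eq i (size l)) addnC rotD; last by rewrite addnC -divn_eq.
rewrite -pv rot_mul_per; last by apply: leq_trans iv; exact: leq_trunc_div.
rewrite pv; set j := (i %% size l)%N.
have jl : (j < size l)%N by rewrite ltn_mod -pv per_gt0.
case: (posnP j) => [->|j0]; first by rewrite rot0.
set a := take j l; set b := drop j l.
have sa : size a = j by rewrite size_takel // ltnW.
have el : a ++ b = l by apply: cat_take_drop.
have a0 : a <> [::] by move=> a0; move: j0; rewrite -sa a0.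
have b0 : b <> [::] by move=> b0; move: jl; rewrite -el b0 cats0 sa ltnn.
rewrite /v -el -sa rot_wpow.
rewrite -el in ll; apply: ltW; apply: lt_cat_size (lyndon_rotate ll a0 b0).
by rewrite !size_cat addnC.
Qed.

Lemma least_rotation_lyndon v :
  v <> [::] -> (forall i, v <= rot i v) -> lyndon (take (per v) v).
Proof.
move=> v0 vmin.
have pv : (per v <= size v)%N.
  by apply: dvdn_leq (per_dvd_size v); rewrite lt0n size_eq0; apply/eqP.
have ev := wpow_per v; set l := take _ _ in ev *; set N := (_ %/ _)%N in ev.
have sl : size l = per v by rewrite size_takel.
have N0 : (0 < N)%N by rewrite divn_gt0 ?per_gt0.
have l0 : l <> [::] by move=> l0; move: (per_gt0 v); rewrite -sl l0.
apply: rotate_lyndon => // a b el a0 b0.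
have ab : size l = size (b ++ a) by rewrite el !size_cat addnC.
have er : rot (size a) v = wpow (b ++ a) N by rewrite {1}ev el rot_wpow.
case: (ltgtP l (b ++ a)) => // [lt|eba].
  have := vmin (size a); rewrite er {1}ev leNgt -(prednK N0) !wpowS.
  by rewrite lt_cat_size.
have : (per v <= size a)%N.
  by apply: per_min; [case: (a) a0 | rewrite er -eba -ev].
rewrite -sl el size_cat -{2}[size a]addn0 leq_add2l leqn0 size_eq0.
by move/eqP/b0.
Qed.

End Periods.

(** * Words up to rotation *)

Lemma count_multiples d q : (0 < d)%N -> (\sum_(0 <= i < q * d) (d %| i) = q)%N.
Proof.
move=> d0; elim: q => [|q IH]; first by rewrite big_geq.
rewrite mulSnr (@big_cat_nat _ _ _ (q * d)) ?leq_addr //= IH.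
rewrite -{1}[(q * d)%N]add0n big_addn addKn -[RHS]addn1; congr addn.
rewrite big_ltn // dvdn_mull // big_nat big1 ?addn0 // => i /andP[i0 lt].
by rewrite dvdn_addl ?dvdn_mull // gtnNdvd.
Qed.

Section Burnside.
Import Order.TTheory Order.DefaultSeqLexiOrder.
Variables (r n : nat).
Hypothesis n0 : (0 < n)%N.
Implicit Types u v w : n.-tuple 'I_r.

(** Rotation of words of length [n]. *)
Definition rott i v : n.-tuple 'I_r := [tuple of rot i v].

(** [v] is the least of its rotations. *)
Definition least_rot v := [forall i : 'I_n, (v <= rot i v :> seq 'I_r)%O].

Lemma least_rotP v :
  reflect (forall i, (v <= rot i v :> seq 'I_r)%O) (least_rot v).
Proof.
apply: (iffP forallP) => h i; last exact: h.
case: (ltnP i n) => [lt|ge]; first exact: h (Ordinal lt).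
by rewrite rot_oversize ?size_tuple.
Qed.

Lemma rott_back i v : exists j, v = rott j (rott i v).
Proof.
exists (size (rot i v) - i)%N; apply: val_inj => /=.
by rewrite -[LHS](rotK i).
Qed.

Lemma rott_rott i j v : exists k, rott i (rott j v) = rott k v.
Proof.
case: (leqP j n) => [jn|/ltnW jn]; last first.
  by exists i; apply: val_inj; rewrite /= [rot j _]rot_oversize ?size_tuple.
case: (leqP i n) => [i_n|/ltnW i_n]; last first.
  by exists j; apply: val_inj; rewrite /= [rot i _]rot_oversize ?size_tuple.
by eexists; apply: val_inj; rewrite /= rot_add_mod ?size_tuple.
Qed.

Lemma per_rott i v : per (rott i v) = per v.
Proof.
have le j w : (per (rott j w) <= per w)%N.
  by apply: per_min (per_gt0 w) _; rewrite /= rot_rot rot_per.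
apply/eqP; rewrite eqn_leq le; have [j {1}->] := rott_back i v.
exact: le.
Qed.

Lemma least_rot_exists v : exists j, least_rot (rott j v).
Proof.
case: (@arg_minP _ _ _ (Ordinal n0) xpredT
  (fun i : 'I_n => rot i v : seq 'I_r) isT) => j _ jmin.
exists j; apply/least_rotP => i /=; have [k ek] := rott_rott i j v.
have -> : rot i (rot j v) = rot k v by case: ek.
case: (ltnP k n) => [lt|ge]; first exact: (jmin (Ordinal lt)).
by have := jmin (Ordinal n0) isT; rewrite rot0 [rot k _]rot_oversize ?size_tuple.
Qed.

Lemma least_rot_uniq u v i : least_rot u -> least_rot v -> v = rott i u -> u = v.
Proof.
move=> /least_rotP hu /least_rotP hv ev; apply: val_inj; apply: le_anti.
have [j ej] := rott_back i u; rewrite -ev in ej.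
by apply/andP; split; [rewrite ev; exact: hu | rewrite ej; exact: hv].
Qed.

(** The least rotation of [v]. *)
Definition least v : n.-tuple 'I_r := rott (xchoose (least_rot_exists v)) v.

Lemma leastP v : least_rot (least v).
Proof. exact: (xchooseP (least_rot_exists v)). Qed.

Lemma card_stabilizer v :
  (\sum_(i < n) (rott i v == v) = n %/ per v)%N.
Proof.
under eq_bigr => i _.
  rewrite -val_eqE /= per_dvdP; last by rewrite size_tuple ltnW.
  over.
have := per_dvd_size v; rewrite size_tuple => /dvdnP[q].
move: (per v) (per_gt0 v) => d d0 eq.
rewrite -(big_mkord xpredT (fun i => (d %| i) : nat)) eq mulnK //.
exact: count_multiples.
Qed.

(** The rotations carrying [v] to a given rotation of [v] are as numerous as
    those that fix [v]. *)
Lemma card_transporter j v :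
  (\sum_(i < n) (rott i v == rott j v) = n %/ per v)%N.
Proof.
have [k [kn ->]] : exists k, (k < n)%N /\ rott j v = rott k v.
  case: (ltnP j n) => [lt|ge]; first by exists j.
  by exists 0%N; split=> //; apply: val_inj; rewrite /= rot0 rot_oversize ?size_tuple.
rewrite -(per_rott k v) -card_stabilizer.
(* Translation by [k], modulo [n], is a bijection of the indices. *)
pose h (i : 'I_n) : 'I_n := Ordinal (ltn_pmod (i + k) n0).
have hinj : injective h.
  move=> i i' /(congr1 val)/eqP /=; rewrite eqn_modDr !modn_small // => /eqP.
  exact: val_inj.
rewrite (reindex_inj hinj) /=; apply: eq_bigr => i _; congr (nat_of_bool (_ == _)).
have [le_i le_k] : (i <= size v)%N /\ (k <= size v)%N.
  by rewrite size_tuple (ltnW kn) (ltnW (ltn_ord i)).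
apply: val_inj => /=; rewrite rot_add_mod // size_tuple.
case: ifP => [le|/negbT]; last rewrite -ltnNge => lt.
  case: (ltngtP (i + k) n) le => // [lt|->] _.
    by rewrite modn_small.
  by rewrite modnn rot0 rot_oversize ?size_tuple.
rewrite -{1}(subnK (ltnW lt)) modnDr modn_small //.
by rewrite ltn_subLR ?(ltnW lt) // -addSn leq_add // ltnW.
Qed.

(** The rotation class of a word [v] has [per v] elements, exactly one of which
    is a least rotation. *)
Lemma card_least_rot (S : {set n.-tuple 'I_r}) (Q : pred nat) :
  (forall i v, v \in S -> rott i v \in S) ->
  (\sum_(v in S | Q (per v)) n %/ per v =
   n * #|[set v in S | least_rot v && Q (per v)]|)%N.
Proof.
move=> Srot; set D := [set v in S | _].
transitivity (\sum_(v in S | Q (per v)) \sum_(i < n) (rott i (least v) == v))%N.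
  apply: eq_bigr => v _.
  have [j ej] : exists j, v = rott j (least v) := rott_back _ v.
  rewrite -(per_rott (xchoose (least_rot_exists v)) v) -/(least v).
  by rewrite -(card_transporter j (least v)) -ej.
rewrite exchange_big; transitivity (\sum_(i < n) #|D|)%N; last first.
  by rewrite sum_nat_const card_ord.
apply: eq_bigr => i _.
rewrite -big_mkcondr /= sum1dep_card.
have rinj : injective (rott i).
  by move=> u v /(congr1 val) /= /rot_inj/val_inj.
rewrite -(card_imset D rinj); apply: eq_card => v; rewrite inE.
apply/idP/imsetP => [/andP[/andP[vS vQ] /eqP e]|[u]].
  exists (least v); rewrite ?e // inE Srot // leastP.
  by rewrite /least per_rott.
rewrite inE => /and3P[uS umin uQ] ->; rewrite Srot // per_rott uQ /=.
apply/eqP; congr (rott i _); have [k ek] := rott_rott (xchoose (least_rot_exists (rott i u))) i u.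
exact/esym/(least_rot_uniq umin (leastP _) ek).
Qed.

End Burnside.

(** * The arithmetic function mu_p *)

Section Moebius.
Implicit Types m M N q s : nat.

Lemma primes_primeM q m : prime q -> ~~ (q %| m)%N -> (0 < m)%N ->
  perm_eq (primes (q * m)) (q :: primes m).
Proof.
move=> qp qm m0; apply: uniq_perm; rewrite /= ?primes_uniq ?andbT //.
  by rewrite mem_primes qp m0.
by move=> x; rewrite primesM ?(prime_gt0 qp) // primes_prime // !inE.
Qed.

Lemma moebius1 : moebius 1 = 1.
Proof. by []. Qed.

Lemma moebius_primeM q m : prime q -> ~~ (q %| m)%N -> (0 < m)%N ->
  moebius (q * m) = - moebius m.
Proof.
move=> qp qm m0; have pe := primes_primeM qp qm m0.
have q0 := prime_gt0 qp.
rewrite /moebius (perm_all _ pe) (perm_size pe) /= lognM // logn_prime // eqxx.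
rewrite lognE qp m0 (negPf qm) addn0 eqxx /=.
rewrite (eq_in_all (a2 := fun l => logn l m == 1%N)) => [|l].
  by case: ifP; rewrite ?oppr0 // exprS mulN1r.
rewrite mem_primes => /and3P[lp _ lm]; rewrite lognM // logn_prime //.
by case: (eqVneq l q) lm => [->|//]; rewrite (negPf qm).
Qed.

Lemma moebius_pow q j m : prime q -> ~~ (q %| m)%N -> (0 < m)%N ->
  moebius (q ^ j.+2 * m) = 0.
Proof.
move=> qp qm m0; rewrite /moebius ifF //; apply/negbTE/allPn; exists q.
  by rewrite mem_primes qp muln_gt0 expn_gt0 (prime_gt0 qp) // m0 expnS -mulnA dvdn_mulr.
by rewrite lognM ?expn_gt0 ?(prime_gt0 qp) // pfactorK // lognE qp m0 (negPf qm).
Qed.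

Lemma moebius_p_pow p j m : prime p -> ~~ (p %| m)%N -> (0 < m)%N ->
  moebius_p p (p ^ j * m) =
    moebius m * (if j is k.+1 then (p ^ k.+1)%:Z - (p ^ k)%:Z else 1).
Proof.
move=> pp pm m0; case: j => [|k].
  by rewrite expn0 mul1n /moebius_p (negPf pm) mulr1.
have lp : logn p (p ^ k.+1 * m) = k.+1.
  by rewrite lognM ?expn_gt0 ?(prime_gt0 pp) // pfactorK // lognE pp m0 (negPf pm) addn0.
rewrite /moebius_p expnS -mulnA dvdn_mulr // mulnA -expnS lp; congr (moebius _ * _).
rewrite partnM ?expn_gt0 ?(prime_gt0 pp) // part_p'nat ?mul1n ?pnatNK ?pnatX ?pnat_id //.
by rewrite part_pnat_id // p'natE.
Qed.

Lemma divisors_prime_pow q s M : prime q -> ~~ (q %| M)%N -> (0 < M)%N ->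
  perm_eq (divisors (q ^ s * M))
    [seq (q ^ j * m)%N | j <- iota 0 s.+1, m <- divisors M].
Proof.
move=> qp qM M0; have qs0 : (0 < q ^ s)%N by rewrite expn_gt0 (prime_gt0 qp).
have qm m : m \in divisors M -> ~~ (q %| m)%N.
  by rewrite -dvdn_divisors // => mM; apply: contra qM => /dvdn_trans; apply.
apply: uniq_perm; first exact: divisors_uniq.
  have : uniq (iota 0 s.+1) by exact: iota_uniq.
  move: (iota 0 s.+1) => I uI; apply: allpairs_uniq; rewrite ?uI ?divisors_uniq // => -[j m] [j' m'].
  move=> /allpairsP[[a b] /= [_ /qm bM [-> ->]]].
  move=> /allpairsP[[a' b'] /= [_ /qm bM' [-> ->]]] e.
  have lq x y : ~~ (q %| y)%N -> logn q (q ^ x * y) = x.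
    move=> qy; have y0 : (0 < y)%N by case: y qy; rewrite ?dvdn0.
    by rewrite lognM ?expn_gt0 ?(prime_gt0 qp) // pfactorK // lognE qp y0 (negPf qy) addn0.
  have ea : a = a' by rewrite -(lq a b) // e lq.
  by move/eqP: e; rewrite ea eqn_pmul2l ?expn_gt0 ?(prime_gt0 qp) // => /eqP->.
move=> d; rewrite -dvdn_divisors ?muln_gt0 ?qs0 //.
apply/idP/allpairsP => [dd|[[j m] [js mM ->]]]; last first.
  move: js mM; rewrite mem_iota ltnS => /= js mM.
  apply: dvdn_mul; last by rewrite dvdn_divisors.
  by apply: dvdn_exp2l.
have d0 : (0 < d)%N by apply: dvdn_gt0 dd; rewrite muln_gt0 qs0.
exists (logn q d, d`_q^')%N; split; last by rewrite -p_part partnC.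
  rewrite mem_iota ltnS /= -(pfactorK s qp).
  have -> : logn q (q ^ s) = logn q (q ^ s * M).
    by rewrite lognM // [logn q M]lognE qp M0 (negPf qM) addn0.
  by apply: dvdn_leq_log; rewrite ?muln_gt0 ?qs0.
rewrite -dvdn_divisors //; have := dvdn_trans (dvdn_part q^' d) dd.
by rewrite Gauss_dvdr // coprime_sym coprimeXl // prime_coprime // -p'natE // part_pnat.
Qed.

(** The divisors of M = q^s M', with q not dividing M', come in pairs m', q m'
    with cancelling values, up to multiples of q^2. *)
Lemma sum_moebius M : (0 < M)%N ->
  \sum_(m <- divisors M) moebius m = (M == 1%N)%:R.
Proof.
move=> M0; have [->|M1] := eqVneq M 1%N; first by rewrite big_seq1 moebius1.
have {}M1 : (1 < M)%N by rewrite ltn_neqAle eq_sym M1.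
have [q qp qM] := pdivP M1; have [M' qM' eM] := pfactor_coprime qp M0.
have {}qM' : ~~ (q %| M')%N by rewrite -prime_coprime.
have M'0 : (0 < M')%N by case: (M') qM'; rewrite ?dvdn0.
have : (0 < logn q M)%N by rewrite logn_gt0 mem_primes qp M0.
move: eM; case: (logn q M) => // s -> _.
rewrite mulnC (perm_big _ (divisors_prime_pow _ qp qM' M'0)) big_allpairs_dep /=.
rewrite !big_cons [X in _ + (_ + X)]big1_seq ?addr0 => [|j]; last first.
  rewrite mem_iota => /= /andP[j2 _]; rewrite big1_seq // => m.
  rewrite -dvdn_divisors // => /= mM; rewrite -(subnK j2) addn2 moebius_pow //.
    by apply: contra qM' => /dvdn_trans; apply.
  exact: dvdn_gt0 mM.
rewrite -big_split big1_seq // => m /=; rewrite -dvdn_divisors // => mM.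
rewrite expn0 mul1n expn1 moebius_primeM ?subrr //.
  by apply: contra qM' => /dvdn_trans; apply.
exact: dvdn_gt0 mM.
Qed.

(** On divisors p^j m of M p^s, the value of mu_p factors; the sum over m is
    zero unless M = 1, and the sum over j telescopes to p^s. *)
Lemma sum_moebius_p p N : prime p -> (0 < N)%N ->
  \sum_(m <- divisors N) moebius_p p m =
    if N == (p ^ logn p N)%N then N%:Z else 0.
Proof.
move=> pp N0; have [M pM eN] := pfactor_coprime pp N0.
have {}pM : ~~ (p %| M)%N by rewrite -prime_coprime.
have M0 : (0 < M)%N by case: (M) pM; rewrite ?dvdn0.
move: eN; set s := logn p N => ->.
have ps0 : (0 < p ^ s)%N by rewrite expn_gt0 (prime_gt0 pp).
rewrite -[X in if _ == X then _ else _]mul1n eqn_pmul2r // mulnC.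
rewrite (perm_big _ (divisors_prime_pow _ pp pM M0)) big_allpairs_dep.
under eq_bigr => j _.
  rewrite (eq_big_seq (fun m => moebius m *
      (if j is k.+1 then (p ^ k.+1)%:Z - (p ^ k)%:Z else 1))); last first.
    move=> m; rewrite -dvdn_divisors // => mM; apply: moebius_p_pow => //.
      by apply: contra pM => /dvdn_trans; apply.
    exact: dvdn_gt0 mM.
  rewrite -mulr_suml sum_moebius //; over.
rewrite -mulr_sumr; case: eqP => [->|_]; last by rewrite mul0r.
rewrite mul1r muln1 -/(index_iota 0 s.+1); elim: s {ps0} => [|s IH].
  by rewrite big_nat1.
by rewrite big_nat_recr //= IH addrC subrK.
Qed.

End Moebius.

(** * Counting words *)

Section Content.
Variable r : nat.
Implicit Types (u v w : seq 'I_r) (alpha : 'X_{1..r}).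

(** The multidegree of a word: the number of occurrences of each letter. *)
Definition content w : 'X_{1..r} := [multinom count_mem i w | i < r].

Lemma content_cat u v : content (u ++ v) = (content u + content v)%MM.
Proof. by apply/mnmP => i; rewrite mnmDE !mnmE count_cat. Qed.

Lemma content_perm u v : perm_eq u v -> content u = content v.
Proof. by move=> /permP e; apply/mnmP => i; rewrite !mnmE e. Qed.

Lemma content1 i : content [:: i] = U_(i)%MM.
Proof. by apply/mnmP => j; rewrite mnmE mnm1E /= addn0. Qed.

Lemma content_wpow u N : content (wpow u N) = (content u *+ N)%MM.
Proof.
elim: N => [|N IH]; first by apply/mnmP => i; rewrite mulmnE !mnmE muln0.
by rewrite wpowS content_cat IH; apply/mnmP => i; rewrite mnmDE !mulmnE mulnS.
Qed.

Lemma mdeg_content w : mdeg (content w) = size w.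
Proof.
elim: w => [|i w IH]; last by rewrite -cat1s content_cat mdegD content1 mdeg1 IH.
by rewrite mdegE big1 // => i _; rewrite mnmE.
Qed.

Lemma card_cons n (P : pred (n.+1.-tuple 'I_r)) :
  #|[set u | P u]| = (\sum_i #|[set u : n.-tuple 'I_r | P [tuple of i :: u]]|)%N.
Proof.
rewrite -sum1dep_card (partition_big (fun u : n.+1.-tuple _ => thead u) xpredT) //=.
apply: eq_bigr => i _; rewrite sum1dep_card.
have cinj : injective (fun u : n.-tuple 'I_r => [tuple of i :: u]).
  by move=> u v /(congr1 val) [] /val_inj.
rewrite -(card_imset _ cinj); apply: eq_card => u; rewrite inE.
apply/andP/imsetP => [[Pu /eqP <-]|[v]].
  exists [tuple of behead u]; last by rewrite -tuple_eta.
  by rewrite inE -tuple_eta.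
by rewrite inE => Pv ->; rewrite Pv theadE.
Qed.

(** The number of words of a given multidegree is a multinomial coefficient. *)
Lemma card_content n alpha : mdeg alpha = n ->
  (#|[set u : n.-tuple 'I_r | content u == alpha]| * \prod_i (alpha i)`! = n`!)%N.
Proof.
elim: n alpha => [|n IH] alpha an.
  move/eqP: an; rewrite mdeg_eq0 => /eqP->.
  rewrite big1 ?muln1 => [|i _]; last by rewrite mnm0E.
  rewrite (eq_card (B := xpredT)) ?card_tuple ?expn0 // => u.
  by rewrite inE tuple0 -mdeg_eq0 mdeg_content.
rewrite card_cons big_distrl /= factS -an mdegE big_distrl /=.
apply: eq_bigr => i _; have [ai0|ai0] := posnP (alpha i).
  rewrite ai0 mul0n (eq_card (B := pred0)) ?card0 // => u.
  rewrite !inE; apply/eqP => e; move: ai0.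
  by rewrite -e -cat1s content_cat mnmDE content1 mnm1E eqxx.
pose beta : 'X_{1..r} := (alpha - U_(i))%MM.
have ab : alpha = (U_(i) + beta)%MM.
  by rewrite addmC submK //; apply/mnm_lepP => j; rewrite mnm1E; case: eqP => // <-.
have bn : mdeg beta = n by move: an; rewrite ab mdegD mdeg1 add1n => -[].
rewrite -(IH beta bn) mulnCA; congr muln.
  apply: eq_card => u; rewrite !inE -[_ :: _]cat1s content_cat content1 ab.
  by rewrite (inj_eq (@addmI _ _)).
rewrite (bigD1 i) //= [in RHS](bigD1 i) //= mulnA; congr muln.
  by rewrite mnmBE mnm1E eqxx subn1 -{1 2}(prednK ai0) factS prednK.
by apply: eq_bigr => j ji; rewrite mnmBE mnm1E eq_sym (negPf ji) subn0.
Qed.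

End Content.

Section Count.
Variables (r n : nat).
Hypothesis n0 : (0 < n)%N.
Implicit Types (u v : n.-tuple 'I_r) (S : {set n.-tuple 'I_r}).

(** The words fixed by the rotation by n / m are the m-th powers. *)
Lemma card_fixed m S : (m %| n)%N ->
  #|[set v in S | rott (n %/ m) v == v]| =
  #|[set u : (n %/ m).-tuple 'I_r | [exists v in S, wpow u m == v]]|.
Proof.
move=> mn; have m0 := dvdn_gt0 n0 mn; set k := (n %/ m)%N.
have nk : n = (m * k)%N by rewrite mulnC divnK.
have k0 : (0 < k)%N by rewrite divn_gt0 // dvdn_leq.
have szw (u : k.-tuple 'I_r) : size (wpow u m) == n by rewrite size_wpow size_tuple -nk.
pose f (u : k.-tuple 'I_r) : n.-tuple 'I_r := Tuple (szw u).
have finj : injective f.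
  move=> u v /(congr1 val) /=; rewrite -(prednK m0) !wpowS => /eqP.
  by rewrite eqseq_cat ?size_tuple // => /andP[/eqP/val_inj].
rewrite -(card_imset _ finj); apply: eq_card => v; rewrite inE.
apply/andP/imsetP => [[vS /eqP/(congr1 val) /= ev]|[u]].
  have kn : (k <= size v)%N by rewrite size_tuple leq_div.
  have st : size (take k v) == k by rewrite size_takel.
  have ew : wpow (take k v) m = v.
    have -> : m = (size v %/ k)%N by rewrite size_tuple nk mulnK.
    by rewrite -wpow_rot // size_tuple nk dvdn_mull.
  exists (Tuple st); last by apply: val_inj.
  by rewrite inE; apply/existsP; exists v; rewrite vS ew /=.
rewrite inE => /existsP[w /andP[wS /eqP ew]] ev.
have -> : v = w by rewrite ev; apply: val_inj.
split=> //; apply/eqP/val_inj => /=; rewrite -ew.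
by have := rot_wpow u [::] m; rewrite cats0 size_tuple.
Qed.

Lemma card_fixed_all m : (m %| n)%N ->
  #|[set v in [set: n.-tuple 'I_r] | rott (n %/ m) v == v]| = (r ^ (n %/ m))%N.
Proof.
move=> mn; rewrite card_fixed // (eq_card (B := xpredT)) ?card_tuple ?card_ord // => u.
have szw : size (wpow u m) == n by rewrite size_wpow size_tuple mulnC divnK.
by rewrite !inE; apply/existsP; exists (Tuple szw); rewrite inE /=.
Qed.

Lemma card_fixed_content m (alpha : 'X_{1..r}) : (m %| n)%N -> mdeg alpha = n ->
  (#|[set v in [set v : n.-tuple 'I_r | content v == alpha]
      | rott (n %/ m) v == v]| * \prod_i (alpha i %/ m)`! =
  [forall i, m %| alpha i] * (n %/ m)`!)%N.
Proof.
move=> mn an; have m0 := dvdn_gt0 n0 mn; rewrite card_fixed //.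
have E (u : (n %/ m).-tuple 'I_r) :
    [exists v in [set v : n.-tuple 'I_r | content v == alpha], wpow u m == v] =
    ((content u *+ m)%MM == alpha).
  apply/existsP/eqP => [[v]|e].
    by rewrite inE => /andP[/eqP <- /eqP <-]; rewrite content_wpow.
  have szw : size (wpow u m) == n by rewrite size_wpow size_tuple mulnC divnK.
  by exists (Tuple szw); rewrite inE /= content_wpow e !eqxx.
case: forallP => [ma|ma]; rewrite ?mul1n ?mul0n.
  pose beta : 'X_{1..r} := [multinom (alpha i %/ m)%N | i < r].
  have ab : alpha = (beta *+ m)%MM.
    by apply/mnmP => i; rewrite mulmnE mnmE divnK.
  have bn : mdeg beta = (n %/ m)%N by rewrite -an ab mdegMn mulnK.
  rewrite -(card_content bn); congr muln; last first.
    by apply: eq_bigr => i _; rewrite mnmE.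
  apply: eq_card => u; rewrite !inE E {1}ab; apply/eqP/eqP => [/mnmP e|->//].
  by apply/mnmP => i; have := e i; rewrite !mulmnE => /eqP; rewrite eqn_pmul2r // => /eqP.
rewrite (eq_card (B := pred0)) ?card0 // => u; rewrite !inE E; apply/eqP => e.
by apply: ma => i; rewrite -e mulmnE dvdn_mull.
Qed.

Variable p : nat.
Hypothesis pp : prime p.

(** The words of [S] that are powers, with exponent a power of [p], of Lyndon
    words: the least rotations [v] for which [n %/ per v] is a power of [p]. *)
Definition pidx S := [set v in S | least_rot v &&
  ((n %/ per v)%N == p ^ logn p (n %/ per v))%N].

Lemma perm_divisors N : (0 < N)%N -> (N %| n)%N ->
  perm_eq (divisors N) [seq m <- index_iota 1 n.+1 | (m %| n)%N && (m %| N)%N].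
Proof.
move=> N0 Nn; apply: uniq_perm; rewrite ?divisors_uniq ?filter_uniq ?iota_uniq // => m.
rewrite -dvdn_divisors // mem_filter mem_index_iota ltnS.
case mN : (m %| N)%N; rewrite ?andbF // andbT (dvdn_trans mN Nn).
by rewrite (dvdn_gt0 N0 mN) dvdn_leq // (dvdn_trans mN Nn).
Qed.

(** For a set [S] closed under rotation: the right-hand side is the sum over
    the words v of [S] of mu_p(m) for m dividing n / per v. *)
Lemma card_pidx S : (forall i v, v \in S -> rott i v \in S) ->
  n%:Z * #|pidx S|%:Z =
  \sum_(1 <= m < n.+1 | (m %| n)%N)
     moebius_p p m * #|[set v in S | rott (n %/ m) v == v]|%:Z.
Proof.
move=> Srot.
have := @card_least_rot r n n0 S
  (fun d => (n %/ d)%N == p ^ logn p (n %/ d))%N Srot.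
move/(congr1 Posz); rewrite PoszM => <-.
rewrite (big_morph Posz PoszD (erefl 0%:Z)) big_mkcondr /=.
under [RHS]eq_bigr => m mn.
  rewrite -sum1dep_card (big_morph Posz PoszD (erefl 0%:Z)) mulr_sumr big_mkcondr /=.
  over.
rewrite exchange_big /=; apply: eq_bigr => v vS.
have pn : (per v %| n)%N by have := per_dvd_size v; rewrite size_tuple.
have N0 : (0 < n %/ per v)%N by rewrite divn_gt0 ?per_gt0 // dvdn_leq.
have Nn : (n %/ per v %| n)%N by apply/dvdnP; exists (per v); rewrite mulnC divnK.
rewrite -(sum_moebius_p pp N0) (perm_big _ (perm_divisors N0 Nn)) big_filter.
rewrite big_mkcondr /=; apply: eq_bigr => m mn; rewrite mulr1.
congr (if _ then _ else _); rewrite -val_eqE /= per_dvdP; last first.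
  by rewrite size_tuple leq_div.
by rewrite !dvdn_divRL // mulnC.
Qed.

End Count.

(** * Iterated commutators in characteristic p *)

Section Ring.
Variables (R : nzRingType) (p : nat).
Hypothesis pchar : p \in [pchar R].
Implicit Types (x y z c : R) (n i : nat).

(** The binomial formula for the commuting operators of left and right
    multiplication by [x], the second one scaled by a central element. *)
Lemma iter_twisted c x z n : (forall y, c * y = y * c) ->
  iter n (fun w => x * w + c * (w * x)) z =
  \sum_(i < n.+1) (c ^+ i * (x ^+ (n - i) * z * x ^+ i)) *+ 'C(n, i).
Proof.
move=> cC; have cX i y : c ^+ i * y = y * c ^+ i.
  by apply/esym/commrX; rewrite /GRing.comm cC.
elim: n => [|n IH]; first by rewrite big_ord1 /= !expr0 !mul1r mulr1.
rewrite iterS {}IH mulr_sumr !mulr_suml mulr_sumr.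
rewrite [in RHS]big_ord_recl /= subn0 !expr0 !bin0 mul1r mulr1.
rewrite [X in X + _ = _]big_ord_recl /= subn0 !expr0 !bin0 mul1r mulr1.
rewrite mulrA -exprS -addrA; congr (_ + _).
have -> : \sum_(i < n.+1) (c ^+ bump 0 i *
      (x ^+ (n.+1 - bump 0 i) * z * x ^+ bump 0 i)) *+ 'C(n.+1, bump 0 i) =
    \sum_(i < n.+1) (c ^+ i.+1 * (x ^+ (n - i) * z * x ^+ i.+1)) *+ 'C(n, i.+1) +
    \sum_(i < n.+1) (c ^+ i.+1 * (x ^+ (n - i) * z * x ^+ i.+1)) *+ 'C(n, i).
  by rewrite -big_split; apply: eq_bigr => i _; rewrite binS mulrnDr.
congr (_ + _).
  rewrite big_ord_recr /= bin_small ?mulr0n ?addr0 //; apply: eq_bigr => i _.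
  rewrite mulrnAr mulrA -cX -mulrA; congr ((_ * _) *+ _).
  by rewrite !mulrA -exprS -subSn.
apply: eq_bigr => i _; rewrite mulrnAl mulrnAr; congr (_ *+ _).
by rewrite mulrA mulrA -exprS -!mulrA -exprSr !mulrA.
Qed.

Lemma bin_pred_p i : (i < p)%N -> ('C(p.-1, i))%:R = (-1) ^+ i :> R.
Proof.
have pp := pcharf_prime pchar; have p0 := prime_gt0 pp.
elim: i => [|i IH] ip; first by rewrite bin0.
have /(congr1 (fun k => k%:R : R)) := binS p.-1 i.
rewrite prednK // natrD IH ?(ltnW ip) //.
have /dvdnP[k ->] : (p %| 'C(p, i.+1))%N by apply: prime_dvd_bin.
rewrite natrM (pcharf0 pchar) mulr0 => /eqP; rewrite eq_sym addr_eq0 => /eqP->.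
by rewrite exprS mulN1r.
Qed.

Lemma iter_twisted_pred_p c x z : (forall y, c * y = y * c) ->
  iter p.-1 (fun w => x * w - c * (w * x)) z =
  \sum_(i < p) c ^+ i * (x ^+ (p.-1 - i) * z * x ^+ i).
Proof.
move=> cC; have p0 := prime_gt0 (pcharf_prime pchar).
rewrite (@eq_iter _ _ (fun w => x * w + (- c) * (w * x))) => [|w]; last first.
  by rewrite mulNr.
rewrite iter_twisted => [|y]; last by rewrite mulNr cC mulrN.
rewrite prednK //; apply: eq_bigr => i _.
rewrite -mulr_natl bin_pred_p // (exprNn c) -!mulrA [LHS]mulrA -exprD addnn.
by rewrite -signr_odd odd_double mul1r.
Qed.

(** The previous sum telescopes when the operator is applied once more. *)
Lemma iter_twisted_p c x z : (forall y, c * y = y * c) ->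
  iter p (fun w => x * w - c * (w * x)) z = x ^+ p * z - c ^+ p * (z * x ^+ p).
Proof.
move=> cC; have p0 := prime_gt0 (pcharf_prime pchar).
have cX i y : c ^+ i * y = y * c ^+ i.
  by apply/esym/commrX; rewrite /GRing.comm cC.
rewrite -[in LHS](prednK p0) iterS iter_twisted_pred_p //.
rewrite mulr_sumr !mulr_suml mulr_sumr -sumrB.
pose f i := c ^+ i * (x ^+ (p - i) * z * x ^+ i).
rewrite (eq_bigr (fun i : 'I_p => f i - f i.+1)) => [|i _]; last first.
  congr (_ - _); last by rewrite /f mulrA mulrA -exprS -!mulrA -exprSr subnS -predn_sub.
  rewrite mulrA -cX -mulrA /f; congr (_ * _).
  by rewrite !mulrA -exprS -subSn ?prednK // -ltnS prednK.
rewrite -(big_mkord xpredT (fun i => f i - f i.+1)) -opprB.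
under eq_bigr => i _ do rewrite -opprB.
rewrite sumrN telescope_sumr // /f opprB expr0 !mul1r subn0 subnn !expr0 mulr1.
by rewrite mul1r opprB.
Qed.

End Ring.

Section Jacobson.
Variables (R : nzRingType) (p : nat).
Hypothesis pchar : p \in [pchar R].
Variables x y : R.

(* The line tx + y. *)
Let a : {poly R} := x%:P * 'X + y%:P.

Lemma deriv_expr n : (a ^+ n)^`() = \sum_(i < n) a ^+ (n.-1 - i) * x%:P * a ^+ i.
Proof.
have da : a^`() = x%:P by rewrite /a derivD derivC addr0 derivM derivC mul0r add0r derivX mulr1.
elim: n => [|n IH]; first by rewrite expr0 derivC big_ord0.
rewrite exprS derivM da IH big_ord_recr /= subnn expr0 mul1r addrC; congr (_ + _).
rewrite mulr_sumr; apply: eq_bigr => i _; rewrite !mulrA -exprS.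
by rewrite -subSn ?prednK //; [case: (n) i => [[]|] | rewrite -ltnS prednK //; case: (n) i => [[]|]].
Qed.

Lemma coef_line q i :
  (a * q)`_i = (if i is j.+1 then x * q`_j else 0) + y * q`_i.
Proof.
by rewrite /a mulrDl -mulrA coefD !coefCM coefXM; case: i => [|i]; rewrite ?mulr0.
Qed.

Lemma coef_line_exp_gt n i : (n < i)%N -> (a ^+ n)`_i = 0.
Proof.
elim: n i => [|n IH] [|i] // ni; first by rewrite expr0 coef1.
by rewrite exprS coef_line !IH ?mulr0 ?addr0 // ltnW.
Qed.

Lemma coef_line_expn n : (a ^+ n)`_n = x ^+ n.
Proof.
elim: n => [|n IH]; first by rewrite !expr0 coef1.
by rewrite !exprS coef_line IH coef_line_exp_gt // mulr0 addr0.
Qed.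

Lemma coef_line_exp0 n : (a ^+ n)`_0 = y ^+ n.
Proof.
elim: n => [|n IH]; first by rewrite !expr0 coef1.
by rewrite !exprS coef_line IH add0r.
Qed.

Lemma exprD_line n : (x + y) ^+ n = \sum_(i < n.+1) (a ^+ n)`_i.
Proof.
have -> : x + y = a.[1] by rewrite /a hornerD hornerMX !hornerC mulr1.
rewrite -horner_exp_comm; last by rewrite /comm_poly mulr1 mul1r.
rewrite (@horner_coef_wide _ n.+1).
  by apply: eq_bigr => i _; rewrite expr1n mulr1.
by apply/leq_sizeP => j nj; rewrite coef_line_exp_gt.
Qed.

(** Jacobson's formula: (x + y)^p is the value at t = 1 of (tx + y)^p, whose
    coefficients other than the extreme ones are determined by
    [jacobson_coef]. *)
Lemma jacobson_formula :
  (x + y) ^+ p = x ^+ p + y ^+ p + \sum_(1 <= i < p) (a ^+ p)`_i.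
Proof.
have p0 := prime_gt0 (pcharf_prime pchar).
rewrite exprD_line big_ord_recr /= coef_line_expn addrC -addrA; congr (_ + _).
rewrite -(big_mkord xpredT (fun i => (a ^+ p)`_i)) big_ltn //.
by rewrite coef_line_exp0.
Qed.

(** The derivative of (tx + y)^p with respect to t is
    (ad (tx + y))^(p-1) x. *)
Lemma jacobson_coef i : (0 < i)%N ->
  (a ^+ p)`_i *+ i = (iter p.-1 (fun q => a * q - q * a) x%:P)`_i.-1.
Proof.
case: i => // i _; rewrite -coef_deriv deriv_expr.
have cp : p \in [pchar {poly R}] by rewrite pchar_poly.
rewrite (@eq_iter _ _ (fun q => a * q - 1 * (q * a))) => [|q]; last by rewrite mul1r.
rewrite (iter_twisted_pred_p cp) => [|q]; last by rewrite mul1r mulr1.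
by under [in RHS]eq_bigr => j _ do rewrite expr1n mul1r.
Qed.

End Jacobson.

(** * The free associative algebra as a color Lie p-algebra *)

Section Bicharacter.
Variables (F : fieldType) (G : zmodType) (gamma : G -> G -> F).
Hypothesis hgamma : color_bicharacter gamma.

Lemma bichar0l h : gamma 0 h = 1.
Proof.
apply: (mulfI (bichar_neq0 hgamma 0 h)).
by rewrite mulr1 -(bicharDl hgamma) addr0.
Qed.

Lemma bichar0r h : gamma h 0 = 1.
Proof.
apply: (mulfI (bichar_neq0 hgamma h 0)).
by rewrite mulr1 -(bicharDr hgamma) addr0.
Qed.

Lemma bicharMnl g h n : gamma (g *+ n) h = gamma g h ^+ n.
Proof.
by elim: n => [|n IH]; rewrite ?bichar0l // mulrS (bicharDl hgamma) IH exprS.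
Qed.

Lemma bicharMnr g h n : gamma g (h *+ n) = gamma g h ^+ n.
Proof.
by elim: n => [|n IH]; rewrite ?bichar0r // mulrS (bicharDr hgamma) IH exprS.
Qed.

End Bicharacter.

(** The free associative algebra on r letters, presented by its basis of words,
    which multiply by concatenation; [wcoef] gives the coordinates in this basis,
    and [wsupp] lists the words with a nonzero coordinate. *)
Record wordAlgebra (F : fieldType) (r : nat) := WordAlgebra {
  walg :> lalgType F;
  word : seq 'I_r -> walg;
  wcoef : seq 'I_r -> {scalar walg};
  wsupp : walg -> seq (seq 'I_r);
  wscaleAr : forall (c : F) (a b : walg), c *: (a * b) = a * (c *: b);
  word1 : word [::] = 1;
  wordM : forall s t, word (s ++ t) = word s * word t;
  wcoef_word : forall s t, wcoef s (word t) = (s == t)%:R;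
  wsupp_uniq : forall a, uniq (wsupp a);
  mem_wsupp : forall a s, (s \in wsupp a) = (wcoef s a != 0);
  wexpand : forall a, a = \sum_(s <- wsupp a) wcoef s a *: word s
}.

Section WordAlgebraExists.
Import monalg.
Variables (F : fieldType) (r : nat).
Local Notation "g @_ k" := (mcoeff k g) : ring_scope.
Local Notation A := {malg F[{fmonom 'I_r}]}.

Lemma malg_scaleAr (c : F) (a b : A) : c *: (a * b) = a * (c *: b).
Proof.
have cc : c%:MP * a = a * c%:MP.
  apply/malgP => k; rewrite mul_malgC mcoeffZ.
  rewrite malgM_def fgmulgU raddf_sum /= {1}(monalgE a) raddf_sum mulr_sumr /=.
  apply: eq_bigr => l _; rewrite mulm1 !mcoeffU mulrnAr; congr (_ *+ _).
  exact: mulrC.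
rewrite -[LHS]mul_malgC -[c *: b]mul_malgC [LHS]mulrA cc; exact/esym/mulrA.
Qed.

(** It is realized as the algebra of the free monoid. *)
Fact free_algebra : wordAlgebra F r.
Proof.
pose e (s : seq 'I_r) : A := << FMonom s >>.
pose co (s : seq 'I_r) : A -> F := mcoeff (FMonom s).
have co_lin s : scalar (co s).
  by move=> c a b; rewrite /co mcoeffD mcoeffZ.
pose coL s : {scalar A} := HB.pack (co s) (GRing.isLinear.Build F A F _ (co s) (co_lin s)).
pose su (a : A) := [seq fmonom_val w | w <- enum_fset (msupp a)].
have vinj : injective (@fmonom_val 'I_r) by move=> [u] [v] /= ->.
have suP a s : (s \in su a) = (coL s a != 0).
  rewrite [RHS](mcoeff_neq0 a (FMonom s)) -[s in LHS]/(fmonom_val (FMonom s)).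
  by rewrite (mem_map vinj).
apply: (@WordAlgebra F r A e coL su malg_scaleAr) => //.
- rewrite /e; have -> : FMonom [::] = mone :> {fmonom 'I_r} by apply/eqP; rewrite fmP fm1.
  reflexivity.
- move=> s t; rewrite /e malgM_def fgmulUU mulr1; congr (<< _ >>).
  by apply/eqP; rewrite fmP fmM.
- by move=> s t; rewrite [LHS]mcoeffU1 fmP eq_sym.
- by move=> a; rewrite map_inj_uniq ?fset_uniq.
- move=> a; rewrite big_map {1}(monalgE a); apply: eq_bigr => k _.
  have -> : coL (fmonom_val k) a = a@_k by rewrite /= /co fmK.
  rewrite /e fmK; apply/malgP => l.
  by rewrite [LHS]mcoeffU [RHS]mcoeffZ mcoeffU1 mulr_natr.
Qed.

End WordAlgebraExists.

Section FreeAlgebra.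
Variables (F : fieldType) (p : nat).
Hypothesis pcharF : p \in [pchar F].
Variables (G : zmodType) (gamma : G -> G -> F).
Hypothesis hgamma : color_bicharacter gamma.
Hypothesis hG : forall g : G, Gplus gamma g.
Variables (r : nat) (deg : 'I_r -> G) (A : wordAlgebra F r).

Implicit Types (a b z : A) (g h : G) (s t u v w : seq 'I_r) (c : F).
Local Notation word := (@word F r A).
Local Notation "a @_ s" := (@wcoef F r A s a) : ring_scope.

Lemma wcoefD s a b : (a + b)@_s = a@_s + b@_s. Proof. exact: raddfD. Qed.
Lemma wcoefB s a b : (a - b)@_s = a@_s - b@_s. Proof. exact: raddfB. Qed.
Lemma wcoef0 s : (0 : A)@_s = 0. Proof. exact: raddf0. Qed.
Lemma wcoefZ s c a : (c *: a)@_s = c * a@_s. Proof. exact: scalarZ. Qed.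

Lemma wcoef_inj a b : (forall s, a@_s = b@_s) -> a = b.
Proof.
move=> ab; apply/eqP; rewrite -subr_eq0 [a - b]wexpand big1 // => s _.
by rewrite wcoefB ab subrr scale0r.
Qed.

Lemma wexprZn c a n : (c *: a) ^+ n = c ^+ n *: a ^+ n.
Proof.
elim: n => [|n IH]; first by rewrite !expr0 scale1r.
by rewrite !exprS IH -scalerAl -wscaleAr scalerA.
Qed.

(** The G-degree of a word. *)
Definition wdeg s : G := \sum_(i <- s) deg i.

Lemma wdeg_cat s t : wdeg (s ++ t) = wdeg s + wdeg t.
Proof. exact: big_cat. Qed.

(** The component of G-degree [g]. *)
Definition fcomp g a : Prop := forall s, a@_s != 0 -> wdeg s = g.

Lemma fcomp_word s : fcomp (wdeg s) (word s).
Proof. by move=> t; rewrite wcoef_word; case: (eqVneq t s) => [->|_] //; rewrite eqxx. Qed.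

(** The linear map with given values on the words. *)
Definition lift (f : seq 'I_r -> A) a : A := \sum_(s <- wsupp a) a@_s *: f s.

Lemma liftw (d : seq (seq 'I_r)) f a : uniq d -> {subset wsupp a <= d} ->
  lift f a = \sum_(s <- d) a@_s *: f s.
Proof.
move=> ud sub; rewrite (bigID (fun s => s \in wsupp a)) /=.
rewrite [X in _ = _ + X]big1 ?addr0 => [|s]; last first.
  by rewrite mem_wsupp negbK => /eqP->; rewrite scale0r.
rewrite -[RHS]big_filter; apply: perm_big; apply: uniq_perm.
- exact: wsupp_uniq.
- exact: filter_uniq.
- by move=> s; rewrite mem_filter; case sa: (s \in wsupp a) => //=; rewrite sub.
Qed.

Lemma lift_linear f : linear (lift f).
Proof.
move=> c a b; pose d := undup (wsupp a ++ wsupp b).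
have ud : uniq d by apply: undup_uniq.
rewrite !(@liftw d) //; try by move=> s sa; rewrite mem_undup mem_cat sa ?orbT.
  rewrite scaler_sumr -big_split; apply: eq_bigr => k _.
  by rewrite wcoefD wcoefZ scalerDl scalerA.
move=> s; rewrite mem_undup mem_cat !mem_wsupp wcoefD wcoefZ.
have [->|//] := eqVneq (a@_s) 0; by rewrite mulr0 add0r.
Qed.

Lemma linear_ext (P Q : A -> A) : linear P -> linear Q ->
  (forall s, P (word s) = Q (word s)) -> P =1 Q.
Proof.
have lin0 (f : A -> A) : linear f -> f 0 = 0.
  by move=> lf; have := lf (-1) 0 0; rewrite scaler0 addr0 scaleN1r addNr.
move=> lP lQ PQ a; rewrite (wexpand a).
elim: (wsupp a) => [|k s IH]; first by rewrite big_nil !lin0.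
by rewrite big_cons lP lQ PQ IH.
Qed.

Lemma fgrading : grading fcomp.
Proof.
split=> [g|a|s f us fg sf0 g gs].
- split=> [w|c a b ha hb w]; first by rewrite wcoef0 eqxx.
  rewrite wcoefD wcoefZ; have [->|/ha //] := eqVneq (a@_w) 0.
  by rewrite mulr0 add0r => /hb.
- pose s := undup [seq wdeg w | w <- wsupp a].
  exists s, (fun g => \sum_(w <- wsupp a | wdeg w == g) a@_w *: word w); split.
    move=> g w; rewrite raddf_sum /= => h; apply/eqP; apply: contraR h => wg.
    rewrite big1 // => v /eqP vg; rewrite wcoefZ wcoef_word.
    by case: (eqVneq w v) => [e|]; rewrite ?mulr0 //; move: wg; rewrite e vg eqxx.
  rewrite (exchange_big_dep xpredT) //= {1}(wexpand a).
  apply: eq_big_seq => w wa; rewrite -big_filter (@perm_big _ _ _ _ _ [:: wdeg w]).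
    by rewrite big_seq1.
  apply: uniq_perm; rewrite ?filter_uniq ?undup_uniq // => g.
  rewrite mem_filter inE eq_sym; case: eqP => //= ->.
  by rewrite mem_undup; apply/mapP; exists w.
apply: wcoef_inj => w; rewrite wcoef0.
have [wg|wg] := eqVneq (wdeg w) g; last first.
  by apply/eqP; apply: contraNT wg => /fg ->.
have /(congr1 (fun a => a@_w)) := sf0; rewrite raddf_sum wcoef0 /=.
rewrite (bigD1_seq g) //= big1 ?addr0 // => h hg.
by apply/eqP; apply: contraNT hg => /fg; rewrite wg => ->.
Qed.

Lemma fcomp_lin g c a b : fcomp g a -> fcomp g b -> fcomp g (c *: a + b).
Proof. by have [_] := grading_subspace fgrading g; apply. Qed.

Lemma fcomp0 g : fcomp g 0.
Proof. by have [] := grading_subspace fgrading g. Qed.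

Lemma fcompZ g c a : fcomp g a -> fcomp g (c *: a).
Proof. by move=> ha; rewrite -[_ *: _]addr0; apply: fcomp_lin (fcomp0 g). Qed.

Lemma fcompD g a b : fcomp g a -> fcomp g b -> fcomp g (a + b).
Proof. by move=> ha hb; rewrite -[a]scale1r; apply: fcomp_lin. Qed.

Lemma fcompB g a b : fcomp g a -> fcomp g b -> fcomp g (a - b).
Proof.
by move=> ha hb; rewrite addrC -scaleN1r; apply: fcomp_lin.
Qed.

Lemma wordM_expand a b : a * b =
  \sum_(u <- wsupp a) \sum_(v <- wsupp b) a@_u *: (b@_v *: word (u ++ v)).
Proof.
rewrite {1}(wexpand a) {1}(wexpand b) mulr_suml; apply: eq_bigr => u _.
rewrite mulr_sumr; apply: eq_bigr => v _.
by rewrite -scalerAl -wscaleAr wordM.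
Qed.

Lemma wcoefM a b w : (a * b)@_w =
  \sum_(u <- wsupp a) \sum_(v <- wsupp b) a@_u * b@_v * (w == u ++ v)%:R.
Proof.
rewrite wordM_expand raddf_sum /=; apply: eq_bigr => u _.
rewrite raddf_sum /=; apply: eq_bigr => v _.
by rewrite !wcoefZ wcoef_word mulrA.
Qed.

Lemma wcoefM_neq0 a b w : (a * b)@_w != 0 ->
  exists u v, [/\ a@_u != 0, b@_v != 0 & w = u ++ v].
Proof.
move=> h; have /hasP[u ua /hasP[v vb /eqP e]] :
    has (fun u => has (fun v => w == u ++ v) (wsupp b)) (wsupp a).
  apply: contraR h => /hasPn h; rewrite wcoefM big1_seq // => u /h /hasPn hu.
  by rewrite big1_seq // => v /hu /negPf ->; rewrite mulr0.
by exists u, v; rewrite -!mem_wsupp.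
Qed.

Lemma fcompM g h a b : fcomp g a -> fcomp h b -> fcomp (g + h) (a * b).
Proof.
move=> ha hb w /wcoefM_neq0[u [v [/ha <- /hb <- ->]]]; exact: wdeg_cat.
Qed.

Lemma fcomp1 : fcomp 0 1.
Proof.
rewrite -(word1 A) (_ : 0 = wdeg [::]); first exact: fcomp_word.
by rewrite /wdeg big_nil.
Qed.

Lemma fcompX g a n : fcomp g a -> fcomp (g *+ n) (a ^+ n).
Proof.
move=> ha; elim: n => [|n IH]; first exact: fcomp1.
by rewrite exprS mulrS; apply: fcompM.
Qed.

(** The color commutator: the bilinear extension of uv - gamma(u, v) vu from
    words. *)
Definition cbracket a b : A := lift (fun u => lift (fun v =>
  word (u ++ v) - gamma (wdeg u) (wdeg v) *: word (v ++ u)) b) a.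

Lemma cbracket_linearl b : linear (cbracket^~ b).
Proof. exact: lift_linear. Qed.

Lemma cbracket_linearr a : linear (cbracket a).
Proof.
move=> c b b'; rewrite /cbracket [lift _ a]/lift [in RHS]/(lift _ a).
rewrite scaler_sumr -big_split.
apply: eq_bigr => k _; rewrite lift_linear scalerDr.
by rewrite !scalerA mulrC.
Qed.

Lemma cbracketE g h a b : fcomp g a -> fcomp h b ->
  cbracket a b = a * b - gamma g h *: (b * a).
Proof.
move=> ha hb; rewrite !wordM_expand [X in _ *: X]exchange_big /=.
rewrite scaler_sumr -sumrB; apply: eq_big_seq => u ua.
rewrite !scaler_sumr -sumrB; apply: eq_big_seq => v vb.
have -> : wdeg u = g by apply: ha; rewrite -mem_wsupp.
have -> : wdeg v = h by apply: hb; rewrite -mem_wsupp.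
rewrite 2!scalerBr; congr (_ - _); rewrite !scalerA; congr (_ *: _).
by ring.
Qed.

Lemma cbracket_comp g h a b :
  fcomp g a -> fcomp h b -> fcomp (g + h) (cbracket a b).
Proof.
move=> ha hb; rewrite (cbracketE ha hb); apply: fcompB; first exact: fcompM.
by apply: fcompZ; rewrite addrC; apply: fcompM.
Qed.

Lemma cbracket_skew g h a b : fcomp g a -> fcomp h b ->
  cbracket a b = - (gamma g h *: cbracket b a).
Proof.
move=> ha hb; rewrite (cbracketE ha hb) (cbracketE hb ha).
by rewrite scalerBr scalerA (bichar_sym hgamma) scale1r opprB.
Qed.

Lemma cbracket_jacobi g h a b z : fcomp g a -> fcomp h b ->
  cbracket a (cbracket b z) =
  cbracket (cbracket a b) z + gamma g h *: cbracket b (cbracket a z).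
Proof.
move=> ha hb.
apply: (linear_ext (P := fun z => cbracket a (cbracket b z))
  (Q := fun z => cbracket (cbracket a b) z + gamma g h *: cbracket b (cbracket a z))).
- by move=> c x y /=; rewrite !cbracket_linearr.
- move=> c x y /=; rewrite !cbracket_linearr !scalerDr !scalerA addrACA.
  by rewrite [gamma g h * c]mulrC.
move=> w; have hw := @fcomp_word w; set k := wdeg w in hw *.
rewrite (cbracketE hb hw) (cbracketE ha hw) (cbracketE ha hb).
have hab : fcomp (g + h) (a * b - gamma g h *: (b * a)).
  by rewrite -cbracketE //; apply: cbracket_comp.
have haw : fcomp (g + k) (a * word w - gamma g k *: (word w * a)).
  by rewrite -cbracketE //; apply: cbracket_comp.
have hbw : fcomp (h + k) (b * word w - gamma h k *: (word w * b)).
  by rewrite -cbracketE //; apply: cbracket_comp.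
rewrite (cbracketE ha hbw) (cbracketE hb haw) (cbracketE hab hw).
rewrite (bicharDl hgamma) !(bicharDr hgamma).
have := bichar_sym hgamma g h; move: (gamma g h) (gamma h g) (gamma g k) (gamma h k).
move=> c1 c1' c2 c3 cc.
rewrite !(mulrBr, mulrBl) -?scalerAl -?wscaleAr -?scalerAl -?wscaleAr !mulrA.
apply: wcoef_inj => l; rewrite !(wcoefB, wcoefD, wcoefZ).
rewrite [c1 * (_ - c1' * c3 * _)]mulrBr (mulrA c1 (c1' * c3)) (mulrA c1 c1') cc mul1r.
by ring.
Qed.

Lemma cbracket_alt g a : fcomp g a -> cbracket a a = 0.
Proof.
by move=> ha; rewrite (cbracketE ha ha) (hG g) scale1r subrr.
Qed.

(** The color Lie algebra of the free associative algebra. *)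
Definition falg_lie : colorLieAlg gamma :=
  ColorLieAlg fgrading cbracket_linearr cbracket_linearl cbracket_comp
    cbracket_skew cbracket_jacobi cbracket_alt.

Lemma pchar_falg : p \in [pchar A].
Proof. by rewrite (pchar_lalg A). Qed.

(** The p-map is the p-th power, whatever the degree. *)
Definition fpmap (g : G) a : A := a ^+ p.

Lemma fpmapZ g (c : F) a : fcomp g a -> fpmap g (c *: a) = c ^+ p *: fpmap g a.
Proof. by move=> _; rewrite /fpmap wexprZn. Qed.

Lemma fpmap_ad g a z : fcomp g a ->
  cbracket (fpmap g a) z = iter p (cbracket a) z.
Proof.
move=> ha; move: z; apply: linear_ext.
- exact: cbracket_linearr.
- move=> c x y; elim: (p) => [|n IH] //=.
  by rewrite IH cbracket_linearr.
move=> w; have hw := @fcomp_word w; set h := wdeg w in hw *; set z := word w.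
rewrite (cbracketE (fcompX (n := p) ha) hw) (bicharMnl hgamma).
have [-> _] : iter p (cbracket a) z =
    iter p (fun x => a * x - (gamma g h)%:A * (x * a)) z /\
    fcomp (g *+ p + h) (iter p (cbracket a) z).
  elim: (p) => [|n [IH IHc]]; first by rewrite add0r.
  split; last by rewrite iterS mulrS -addrA; apply: cbracket_comp.
  rewrite !iterS -IH (cbracketE ha IHc) mulr_algl (bicharDr hgamma).
  by rewrite (bicharMnr hgamma) (hG g) expr1n mul1r.
rewrite (iter_twisted_p pchar_falg) => [|x]; last by rewrite mulr_algl -wscaleAr mulr1.
by rewrite wexprZn expr1n mulr_algl.
Qed.

(** The color commutator of elements whose degrees are multiples of g is their
    commutator, as gamma(g, g) = 1; so [tbracket] with ta + b is a commutator of
    polynomials. *)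
Lemma tbracketE g (q : {poly A}) n (a b : A) (t : nat -> falg_lie) :
  fcomp g a -> fcomp g b -> (forall i, fcomp (g *+ n) q`_i) ->
  (forall i, t i = q`_i) ->
  forall i, tbracket (L := falg_lie) (fun k => [:: b; a]`_k) t i =
    ((a%:P * 'X + b%:P) * q - q * (a%:P * 'X + b%:P))`_i /\
    fcomp (g *+ n.+1) ((a%:P * 'X + b%:P) * q - q * (a%:P * 'X + b%:P))`_i.
Proof.
move=> ha hb hq tq i; set l := a%:P * 'X + b%:P.
have lc k : l`_k = [:: b; a]`_k.
  by rewrite coefD coefMX !coefC; case: k => [|[|[|k]]] /=; rewrite ?add0r ?addr0.
have hl k : fcomp g l`_k.
  by rewrite lc; case: k => [|[|[|k]]] //=; apply: fcomp0.
have -> : (l * q - q * l)`_i =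
    \sum_(k < i.+1) cbracket l`_k q`_(i - k).
  rewrite coefB coefM coefMr -sumrB; apply: eq_bigr => k _.
  rewrite (cbracketE (hl k) (hq _)) (bicharMnr hgamma) (hG g) expr1n scale1r //.
split; first by apply: eq_bigr => k _; rewrite /= lc tq.
rewrite mulrS; elim/big_ind: _ => [|x y|k _]; [exact: fcomp0|exact: fcompD|].
exact: cbracket_comp.
Qed.

Lemma fpmapD g a b : fcomp g a -> fcomp g b ->
  fpmap g (a + b) = fpmap g a + fpmap g b +
    \sum_(1 <= i < p) jacobson_s p (L := falg_lie) i a b.
Proof.
move=> ha hb; rewrite /fpmap (jacobson_formula pchar_falg); congr (_ + _).
rewrite big_nat [RHS]big_nat; apply: eq_bigr => i /andP[i0 ip].
set l := a%:P * 'X + b%:P.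
have E n j : iter n (tbracket (L := falg_lie) (fun k => [:: b; a]`_k))
      (fun k => [:: a]`_k) j = (iter n (fun q => l * q - q * l) a%:P)`_j /\
    fcomp (g *+ n.+1) (iter n (fun q => l * q - q * l) a%:P)`_j.
  elim: n j => [|n IH] k.
    rewrite /= coefC; case: k => [|k] /=; rewrite ?nth_nil //.
    by split=> //; exact: fcomp0.
  by apply: tbracketE => // j; have [] := IH j.
rewrite /jacobson_s (E p.-1 i.-1).1 -(jacobson_coef pchar_falg _ _ i0).
rewrite -scaler_nat scalerA mulVf ?scale1r //.
apply/eqP => /eqP; rewrite -(dvdn_pcharf pcharF) => /(dvdn_leq i0).
by rewrite leqNgt ip.
Qed.

(** The color Lie p-algebra of the free associative algebra. *)
Definition falg_plie : colorLiePAlg p gamma :=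
  @ColorLiePAlg F p G gamma falg_lie fpmap (fun g a => @fcompX g a p)
    fpmapZ fpmap_ad fpmapD.

Import Order.TTheory Order.DefaultSeqLexiOrder.

(** All the words of [a] have the length of [s], the least of them is [s], and
    its coefficient is 1. *)
Definition leads s a : Prop :=
  (forall w, a@_w != 0 -> size w = size s /\ (s <= w)%O) /\ a@_s = 1.

Lemma leads_word s : leads s (word s).
Proof.
split=> [w|]; rewrite wcoef_word ?eqxx //.
by case: (eqVneq w s) => [-> //|]; rewrite eqxx.
Qed.

Lemma leadsM s t a b : leads s a -> leads t b -> leads (s ++ t) (a * b).
Proof.
move=> [ha sa] [hb tb]; split=> [w /wcoefM_neq0[u [v [/ha[su lu] /hb[sv lv] ->]]]|].
  rewrite !size_cat su sv; split=> //.
  by apply: le_trans (le_cat_size _ (esym su) lu) _; rewrite le_cat2l.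
have sin : s \in wsupp a by rewrite mem_wsupp sa oner_eq0.
have tin : t \in wsupp b by rewrite mem_wsupp tb oner_eq0.
have E u v : u \in wsupp a -> (s ++ t == u ++ v) = (s == u) && (t == v).
  by rewrite mem_wsupp => /ha[su _]; rewrite eqseq_cat.
rewrite wcoefM (bigD1_seq s) ?wsupp_uniq //=.
rewrite [X in _ + X]big_seq_cond [X in _ + X]big1 => [|u /andP[ua us]]; last first.
  by rewrite big1 // => v _; rewrite E // eq_sym (negPf us) mulr0.
rewrite addr0 (bigD1_seq t) ?wsupp_uniq //= big1 => [|v vt]; last first.
  by rewrite E // [t == v]eq_sym (negPf vt) andbF mulr0.
by rewrite addr0 sa tb eqxx !mulr1.
Qed.

Lemma leadsX s a n : leads s a -> leads (wpow s n) (a ^+ n).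
Proof.
move=> ha; elim: n => [|n IH]; first by rewrite expr0 -(word1 A); apply: leads_word.
by rewrite exprS wpowS; apply: leadsM.
Qed.

Lemma leads_bracket g h s t (a b : falg_plie) : comp g a -> comp h b ->
  leads s a -> leads t b -> (s ++ t < t ++ s)%O ->
  leads (s ++ t) (bracket a b).
Proof.
move=> ga hb la lb lt; rewrite [bracket _ _](cbracketE ga hb).
have [hab ab1] := leadsM la lb; have [hba _] := leadsM lb la.
split=> [w|].
  rewrite wcoefB wcoefZ; have [->|/hab //] := eqVneq (((a : A) * (b : A))@_w) 0.
  rewrite sub0r oppr_eq0 mulf_eq0 negb_or => /andP[_ /hba[sw lw]].
  by rewrite sw !size_cat addnC (ltW (lt_le_trans lt lw)).
rewrite wcoefB wcoefZ ab1; have [->|/hba[_]] :=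
  eqVneq (((b : A) * (a : A))@_(s ++ t)) 0; first by rewrite mulr0 subr0.
by rewrite leNgt lt.
Qed.

Lemma leads_pmap g s (a : falg_plie) : leads s a -> leads (wpow s p) (pmap g a).
Proof. exact: leadsX. Qed.

(** Elements with distinct least words are linearly independent. *)
Lemma leads_free (I : finType) (s : I -> seq 'I_r) (a : I -> falg_plie) :
  injective s -> (forall i, leads (s i) (a i)) ->
  forall c : I -> F, \sum_i c i *: a i = 0 -> forall i, c i = 0.
Proof.
move=> sinj ha c ca0 i; apply/eqP; apply: contraT => ci.
case: (@arg_minP _ _ _ i (fun i => c i != 0) s ci) => j cj jmin.
have /(congr1 (fun z : A => z@_(s j))) := ca0.
rewrite raddf_sum wcoef0 (bigD1 j) //= wcoefZ (ha j).2 mulr1 big1 ?addr0.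
  by move=> cj0; rewrite cj0 eqxx in cj.
move=> k kj; rewrite wcoefZ; have [->|/jmin jk] := eqVneq (c k) 0.
  by rewrite mul0r.
have [->|/(ha k).1[_ kj']] := eqVneq ((a k : A)@_(s j)) 0.
  by rewrite mulr0.
by case/eqP: kj; apply: sinj; apply: le_anti; rewrite kj' jk.
Qed.

End FreeAlgebra.

(** * Spanning by p-powers of standard brackets *)

Section Span.
Variables (F : fieldType) (V : lmodType F).
Implicit Types (P Q : V -> Prop) (u v : V).

(** The linear span of a set of vectors. *)
Inductive lspan P : V -> Prop :=
| lspan0 : lspan P 0
| lspan_cons c u v : P u -> lspan P v -> lspan P (c *: u + v).

Lemma lspan_subspace P W : subspace W -> (forall u, P u -> W u) ->
  forall v, lspan P v -> W v.
Proof. by move=> [W0 WD] PW v; elim=> // c {}u {}v /PW Wu _; apply: WD. Qed.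

Lemma lspanD P u v : lspan P u -> lspan P v -> lspan P (u + v).
Proof.
move=> hu hv; elim: hu => [|c u1 u2 Pu _ IH]; first by rewrite add0r.
by rewrite -addrA; apply: lspan_cons.
Qed.

Lemma lspanZ P c u : lspan P u -> lspan P (c *: u).
Proof.
elim=> [|d u1 u2 Pu _ IH]; first by rewrite scaler0; apply: lspan0.
by rewrite scalerDr scalerA; apply: lspan_cons.
Qed.

Lemma lspanN P u : lspan P u -> lspan P (- u).
Proof. by rewrite -scaleN1r; apply: lspanZ. Qed.

Lemma lspan_gen P u : P u -> lspan P u.
Proof.
by move=> Pu; rewrite -[u]addr0 -[u]scale1r; apply: lspan_cons (lspan0 P).
Qed.

Lemma subspace_lspan P : subspace (lspan P).
Proof. by split=> [|c u v hu hv]; [exact: lspan0 | exact: lspanD (lspanZ _ hu) hv]. Qed.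

Lemma lspan_mono P Q : (forall u, P u -> Q u) -> forall u, lspan P u -> lspan Q u.
Proof.
move=> PQ; apply: lspan_subspace (subspace_lspan Q) _ => u Pu.
exact/lspan_gen/PQ.
Qed.

Lemma lspan_map P Q (f : V -> V) : linear f ->
  (forall u, P u -> lspan Q (f u)) -> forall u, lspan P u -> lspan Q (f u).
Proof.
move=> lf PQ u; elim=> [|c {}u v Pu _ IH].
  have -> : f 0 = 0 by have := lf (-1) 0 0; rewrite scaler0 addr0 scaleN1r addNr.
  exact: lspan0.
by rewrite lf; apply: lspanD => //; apply/lspanZ/PQ.
Qed.

Lemma subspaceP W : subspace W ->
  [/\ W 0, forall u v, W u -> W v -> W (u + v) & forall c u, W u -> W (c *: u)].
Proof.
move=> [W0 WD]; split=> // [u v Wu Wv|c u Wu]; first by rewrite -[u]scale1r; apply: WD.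
by rewrite -[_ *: _]addr0; apply: WD.
Qed.

End Span.

Section Standard.
Import Order.TTheory Order.DefaultSeqLexiOrder.
Variables (F : fieldType) (p : nat).
Hypothesis pcharF : p \in [pchar F].
Variables (G : zmodType) (gamma : G -> G -> F) (r : nat) (deg : 'I_r -> G).
Variables (L : colorLiePAlg p gamma) (x : 'I_r -> L).
Hypothesis hx : forall i, comp (deg i) (x i).

Local Notation tree := (@tree _ 'I_r).
Implicit Types (t : tree) (alpha beta : 'X_{1..r}) (k n : nat) (z : L).

(** The value in L of a bracket arrangement. *)
Fixpoint ev t : L :=
  match t with Leaf i => x i | Node a b => bracket (ev a) (ev b) end.

Lemma ev_comp t : comp (wdeg deg (fw t)) (ev t).
Proof.
elim: t => [i|a IHa b IHb] /=; first by rewrite /wdeg big_seq1.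
by rewrite wdeg_cat; apply: bracket_comp.
Qed.

(** The number of words of length at most [n] smaller than [v]. *)
Definition rank n (v : seq 'I_r) := #|[set b : n.-bseq 'I_r | (b < v :> seq 'I_r)%O]|.

Lemma rank_lt n (u v : seq 'I_r) :
  (size u <= n)%N -> (u < v)%O -> (rank n u < rank n v)%N.
Proof.
move=> un uv; apply: proper_card; apply/properP; split.
  by apply/subsetP => b; rewrite !inE => /lt_trans; apply.
by exists (Bseq un); rewrite inE /= ?uv // ltxx.
Qed.

(** The standard brackets of the multidegree of [bracket (ev t1) (ev t2)] whose
    words lie between the product of the words and the right word. *)
Definition between t1 t2 z := exists t,
  [/\ std t, z = ev t, perm_eq (fw t) (fw t1 ++ fw t2),
      (fw t1 ++ fw t2 <= fw t)%O & (fw t < fw t2)%O].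

Lemma between_node t1 t2 : std (Node t1 t2) -> between t1 t2 (ev (Node t1 t2)).
Proof.
move=> st; have /and4P[st1 st2 lt _] := st; exists (Node t1 t2); split=> //=.
by apply: lyndon_cat_lt => //; apply: std_lyndon.
Qed.

(** Brackets of standard brackets are straightened by the Jacobi identity. The
    bounds on the words that occur make the induction work, on the total length
    first and on the right word next. *)
Lemma straighten t1 t2 : std t1 -> std t2 -> (fw t1 < fw t2)%O ->
  lspan (between t1 t2) (bracket (ev t1) (ev t2)).
Proof.
have [n] := ubnP (size (fw t1 ++ fw t2)); elim: n t1 t2 => // n IHn t1 t2.
rewrite ltnS leq_eqVlt => /orP[/eqP en|]; last exact: IHn.
have [m] := ubnP (rank n (fw t2)); elim: m t1 t2 en => // m IHm t1 t2 en.
rewrite ltnS => hm st1 st2 lt12.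
case: t1 en st1 lt12 => [i|a b] en st1 lt12.
  by apply: lspan_gen; apply: (@between_node (Leaf i)); apply/and4P.
have [le2b|lt2b] := leP (fw t2) (fw b).
  by apply: lspan_gen; apply: (@between_node (Node a b)); apply/and4P.
have /and4P[sta stb ltab _] := st1.
have ab_a : (fw a < fw a ++ fw b)%O.
  by rewrite -[X in (X < _)%O]cats0 lt_cat2l ltxi0s; apply/eqP/fw_neq0.
have lu := std_lyndon st1; rewrite /= in lu lt12 en.
have lb := std_lyndon stb; have l2 := std_lyndon st2.
have sza : (0 < size (fw a))%N by rewrite lt0n size_eq0; apply/eqP/fw_neq0.
have szb : (0 < size (fw b))%N by rewrite lt0n size_eq0; apply/eqP/fw_neq0.
(* The induction hypothesis for the same total length and a smaller right
   word. *)
have IH t3 t4 : std t3 -> std t4 -> size (fw t3 ++ fw t4) = n ->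
    (fw t4 < fw t2)%O -> (fw t3 < fw t4)%O ->
    lspan (between t3 t4) (bracket (ev t3) (ev t4)).
  move=> s3 s4 sz lt42 lt34; apply: IHm => //; apply: leq_trans hm.
  by apply: rank_lt lt42; rewrite -sz size_cat leq_addl.
rewrite [ev (Node _ _)]/=.
have -> : bracket (bracket (ev a) (ev b)) (ev t2) =
    bracket (ev a) (bracket (ev b) (ev t2)) -
    gamma (wdeg deg (fw a)) (wdeg deg (fw b)) *:
      bracket (ev b) (bracket (ev a) (ev t2)).
  by rewrite (bracket_jacobi (ev t2) (ev_comp a) (ev_comp b)) addrK.
apply: lspanD.
  have sz : (size (fw b ++ fw t2) < n)%N.
    by rewrite -en !size_cat -addnA -[X in (X < _)%N]add0n ltn_add2r.
  apply: (lspan_map (bracket_linearr (ev a)) _ (IHn b t2 sz stb st2 lt2b)).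
  move=> _ [t [st -> pt le_t lt_t]].
  have leb2 : (fw b < fw t)%O.
    apply: lt_le_trans le_t.
    by rewrite -[X in (X < _)%O]cats0 lt_cat2l ltxi0s; apply/eqP/fw_neq0.
  have := IH a t sta st _ lt_t (lt_trans ltab leb2).
  rewrite size_cat (perm_size pt) -size_cat catA => /(_ en).
  apply: lspan_mono => _ [t' [st' -> pt' le_t' lt_t']]; exists t'; split=> //.
  - by rewrite (perm_trans pt') //= -catA perm_cat2l.
  - by rewrite /= -catA; apply: le_trans le_t'; rewrite le_cat2l.
  - exact: lt_trans lt_t' lt_t.
apply/lspanN/lspanZ.
have lta2 : (fw a < fw t2)%O by apply: lt_trans ab_a lt12.
have sza2 : (size (fw a ++ fw t2) < n)%N.
  by rewrite -en !size_cat ltn_add2r -[X in (X < _)%N]addn0 ltn_add2l.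
apply: (lspan_map (bracket_linearr (ev b)) _ (IHn a t2 sza2 sta st2 lta2)).
move=> _ [t [st -> pt le_t lt_t]].
have sz : size (fw b ++ fw t) = n.
  by rewrite size_cat (perm_size pt) -en !size_cat addnA [(size (fw b) + _)%N]addnC.
have perm_bt t' : perm_eq (fw t') (fw b ++ fw t) ->
    perm_eq (fw t') ((fw a ++ fw b) ++ fw t2).
  move=> pt'; apply: (perm_trans pt'); rewrite -catA perm_sym perm_catCA.
  by rewrite perm_cat2l perm_sym.
case: (ltgtP (fw b) (fw t)) => [lt_bt|lt_tb|ebt].
- have := IH b t stb st sz lt_t lt_bt.
  apply: lspan_mono => _ [t' [st' -> pt' le_t' lt_t']]; exists t'; split=> //=.
  + exact: perm_bt.
  + apply: le_trans le_t'; apply: ltW; apply: lt_ext.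
      by have [_] := lu; apply=> //; apply: fw_neq0.
    exact: proper_suffix_nprefix (@fw_neq0 _ _ a) erefl.
  + exact: lt_trans lt_t' lt_t.
- rewrite (bracket_skew (ev_comp b) (ev_comp t)); apply/lspanN/lspanZ.
  have szt : size (fw t ++ fw b) = n by rewrite size_cat addnC -size_cat.
  have := IH t b st stb szt lt2b lt_tb.
  apply: lspan_mono => _ [t' [st' -> pt' le_t' lt_t']]; exists t'; split=> //=.
  + by apply: perm_bt; rewrite (perm_trans pt') // perm_catC.
  + apply: le_trans le_t'; apply: le_trans (le_cat_size (fw b) _ le_t); last first.
      by rewrite (perm_size pt).
    by rewrite -!catA le_cat2l; apply/ltW/lyndon_swap.
  + exact: lt_trans lt_t' lt2b.
- by rewrite (fw_inj stb st ebt) (bracket_alt (ev_comp t)); apply: lspan0.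
Qed.

(** The span of the standard brackets of multidegree [alpha]. *)
Definition stdspan alpha := lspan (fun z => exists t,
  [/\ std t, z = ev t & content (fw t) = alpha]).

Lemma stdspan_bracket_std t1 t2 : std t1 -> std t2 ->
  stdspan (content (fw t1) + content (fw t2))%MM (bracket (ev t1) (ev t2)).
Proof.
move=> st1 st2.
have sub t3 t4 z : lspan (between t3 t4) z ->
    stdspan (content (fw t3) + content (fw t4))%MM z.
  apply: lspan_mono => _ [t [st -> pt _ _]]; exists t; split=> //.
  by rewrite (content_perm pt) content_cat.
case: (ltgtP (fw t1) (fw t2)) => [lt|lt|e].
- exact/sub/straighten.
- rewrite (bracket_skew (ev_comp t1) (ev_comp t2)) addmC.
  exact/lspanN/lspanZ/sub/straighten.
- by rewrite (fw_inj st1 st2 e) (bracket_alt (ev_comp t2)); apply: lspan0.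
Qed.

Lemma stdspan_iter t n beta z : std t -> stdspan beta z ->
  stdspan (content (fw t) *+ n + beta)%MM (iter n (bracket (ev t)) z).
Proof.
move=> st hz; elim: n => [|n IH].
  by rewrite mulm0n add0m.
rewrite iterS mulmS -addmA.
apply: (lspan_map (bracket_linearr (ev t)) _ IH) => _ [t' [st' -> <-]].
exact: stdspan_bracket_std.
Qed.

(** The p^k-th power of the value of a bracket arrangement. *)
Fixpoint pev t k : L :=
  if k is k'.+1 then pmap (wdeg deg (fw t) *+ p ^ k') (pev t k') else ev t.

Lemma pev_comp t k : comp (wdeg deg (fw t) *+ p ^ k) (pev t k).
Proof.
elim: k => [|k IH] /=; first exact: ev_comp.
by rewrite expnSr mulrnA; apply: pmap_comp.
Qed.

Lemma bracket_pev t k z :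
  bracket (pev t k) z = iter (p ^ k) (bracket (ev t)) z.
Proof.
elim: k z => [|k IH] z //=.
rewrite (pmap_ad z (pev_comp t k)) expnS iterM.
exact: eq_iter.
Qed.

(** The span of the p-powers of standard brackets that have multidegree
    [alpha]. *)
Definition pspan alpha := lspan (fun z => exists t k,
  [/\ std t, z = pev t k & (content (fw t) *+ p ^ k)%MM = alpha]).

Lemma stdspan_pspan alpha z : stdspan alpha z -> pspan alpha z.
Proof.
by apply: lspan_mono => _ [t [st -> <-]]; exists t, 0%N.
Qed.

(** Brackets of p-powers reduce to iterated brackets. *)
Lemma pspan_bracket alpha beta u v :
  pspan alpha u -> pspan beta v -> pspan (alpha + beta)%MM (bracket u v).
Proof.
move=> hu hv; apply: (lspan_map (bracket_linearl v) _ hu) => _ [t [k [st -> <-]]].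
apply: (lspan_map (bracket_linearr (pev t k)) _ hv) => _ [t' [k' [st' -> <-]]].
apply: stdspan_pspan; rewrite bracket_pev.
have pk0 : (0 < p ^ k)%N by rewrite expn_gt0 (prime_gt0 (pcharf_prime pcharF)).
rewrite -(prednK pk0) iterSr mulmSr -addmA; apply: stdspan_iter => //.
rewrite (bracket_skew (ev_comp t) (pev_comp t' k')) bracket_pev addmC.
by apply/lspanN/lspanZ/stdspan_iter => //; apply: lspan_gen; exists t.
Qed.

(** The G-degree of the elements of a given multidegree. *)
Definition gdeg alpha : G := \sum_i deg i *+ alpha i.

Lemma gdeg_content (s : seq 'I_r) : gdeg (content s) = wdeg deg s.
Proof.
elim: s => [|i s IH].
  by rewrite /wdeg big_nil /gdeg big1 // => i _; rewrite mnmE.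
rewrite /wdeg big_cons -/(wdeg deg s) -IH /gdeg -cat1s content_cat content1.
under eq_bigr => j _ do rewrite mnmDE mulrnDr.
rewrite big_split /=; congr (_ + _); rewrite (bigD1 i) //= mnm1E eqxx big1 ?addr0 //.
by move=> j ji; rewrite mnm1E eq_sym (negPf ji).
Qed.

Lemma gdegMn alpha n : gdeg (alpha *+ n)%MM = gdeg alpha *+ n.
Proof. by rewrite /gdeg -sumrMnl; apply: eq_bigr => i _; rewrite mulmnE mulrnA. Qed.

Lemma pspan_comp alpha z : pspan alpha z -> comp (gdeg alpha) z.
Proof.
apply: lspan_subspace; first exact: grading_subspace (comp_grading L) _.
by move=> _ [t [k [_ -> <-]]]; rewrite gdegMn gdeg_content; apply: pev_comp.
Qed.

Lemma pspan_tbracket alpha n (s t : nat -> L) :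
  (forall i, pspan alpha (s i)) -> (forall i, pspan (alpha *+ n)%MM (t i)) ->
  forall i, pspan (alpha *+ n.+1)%MM (tbracket s t i).
Proof.
move=> hs ht i; rewrite /tbracket mulmS.
have [s0 sD _] := subspaceP (subspace_lspan (fun z => exists t k,
  [/\ std t, z = pev t k & (content (fw t) *+ p ^ k)%MM = (alpha + alpha *+ n)%MM])).
by elim/big_ind: _ => // j _; apply: pspan_bracket.
Qed.

Lemma pspan_jacobson alpha i u v : pspan alpha u -> pspan alpha v ->
  pspan (alpha *+ p)%MM (jacobson_s p i u v).
Proof.
move=> hu hv; apply: lspanZ.
have E n j : pspan (alpha *+ n.+1)%MM
    (iter n (tbracket (fun k => [:: v; u]`_k)) (fun k => [:: u]`_k) j).
  elim: n j => [|n IH] j /=.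
    by rewrite mulm1n; case: j => [|j] //=; rewrite nth_nil; apply: lspan0.
  apply: pspan_tbracket => // -[|[|k]] //=; rewrite nth_nil; exact: lspan0.
by have := E p.-1 i.-1; rewrite (prednK (prime_gt0 (pcharf_prime pcharF))).
Qed.

Lemma pspan_pmap alpha u :
  pspan alpha u -> pspan (alpha *+ p)%MM (pmap (gdeg alpha) u).
Proof.
have p0 := prime_gt0 (pcharf_prime pcharF).
elim=> [|c z v zgen hv IH].
  have : comp (gdeg alpha) (0 : L).
    by have [] := grading_subspace (comp_grading L) (gdeg alpha).
  move/(@pmapZ _ _ _ _ L _ 0); rewrite scaler0 => ->.
  by rewrite expr0n -leqn0 leqNgt p0 scale0r; apply: lspan0.
have hz : pspan alpha z by apply: lspan_gen.
rewrite (pmapD (pspan_comp (lspanZ c hz)) (pspan_comp hv)).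
rewrite (pmapZ _ (pspan_comp hz)).
apply: lspanD; first apply: lspanD => //.
  apply: lspanZ; case: zgen => t [k [st -> <-]].
  rewrite gdegMn gdeg_content; apply: lspan_gen; exists t, k.+1; split=> //.
  by apply/mnmP => i; rewrite !mulmnE expnSr mulnA.
have [s0 sD _] := subspaceP (subspace_lspan (fun z => exists t k,
  [/\ std t, z = pev t k & (content (fw t) *+ p ^ k)%MM = (alpha *+ p)%MM])).
elim/big_ind: _ => // i _; apply: pspan_jacobson => //; exact: lspanZ.
Qed.

Lemma mdcomp_pspan alpha z : mdcomp x alpha z -> pspan alpha z.
Proof.
elim=> {alpha z} [i|alpha|alpha c u v _ hu _ hv|alpha beta u v _ hu _ hv
  |alpha g u _ hu gu].
- apply: lspan_gen; exists (Leaf i), 0%N; split=> //.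
  by rewrite content1 expn0 mulm1n.
- exact: lspan0.
- exact: lspanD (lspanZ c hu) hv.
- exact: pspan_bracket.
have [->|ga] := eqVneq g (gdeg alpha); first exact: pspan_pmap.
(* An element of two distinct components vanishes. *)
have u0 : u = 0.
  pose f h := if h == g then u else if h == gdeg alpha then - u else 0.
  have fg : f g = u by rewrite /f eqxx.
  rewrite -fg; apply: (grading_indep (comp_grading L) (s := [:: g; gdeg alpha])).
  - by rewrite /= inE ga.
  - move=> h; rewrite /f.
    have [c0 _ cZ] := subspaceP (grading_subspace (comp_grading L) h).
    case: eqP => [-> //|_]; case: eqP => // e; rewrite -scaleN1r; apply: cZ.
    by rewrite e; apply: pspan_comp.
  - by rewrite !big_cons big_nil /f !eqxx eq_sym (negPf ga) addr0 subrr.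
  - by rewrite inE eqxx.
rewrite u0 in gu *; have := pmapZ (0 : F) gu; rewrite scaler0 => ->.
rewrite expr0n -leqn0 leqNgt (prime_gt0 (pcharf_prime pcharF)) scale0r.
exact: lspan0.
Qed.

Lemma ev_mdcomp t : mdcomp x (content (fw t)) (ev t).
Proof.
elim: t => [i|a IHa b IHb] /=; first by rewrite content1; apply: Mdcomp_gen.
by rewrite content_cat; apply: Mdcomp_bracket.
Qed.

Lemma pev_mdcomp t k : mdcomp x (content (fw t) *+ p ^ k)%MM (pev t k).
Proof.
elim: k => [|k IH] /=; first by rewrite mulm1n; apply: ev_mdcomp.
have -> : (content (fw t) *+ p ^ k.+1)%MM = (content (fw t) *+ p ^ k *+ p)%MM.
  by apply/mnmP => i; rewrite !mulmnE expnSr mulnA.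
by apply: Mdcomp_pmap IH _; apply: pev_comp.
Qed.

End Standard.

(** * Dimensions *)

Lemma wpow_mul r (s : seq 'I_r) (n m : nat) : wpow (wpow s n) m = wpow s (m * n).
Proof.
have wpowD a b : wpow s (a + b) = wpow s a ++ wpow s b.
  by elim: a => //= a IH; rewrite addSn !wpowS IH catA.
by elim: m => // m IH; rewrite wpowS IH mulSn wpowD.
Qed.

Section Dimension.
Import Order.TTheory Order.DefaultSeqLexiOrder.
Variables (F : fieldType) (p : nat).
Hypothesis pcharF : p \in [pchar F].
Variables (G : zmodType) (gamma : G -> G -> F).
Hypothesis hgamma : color_bicharacter gamma.
Hypothesis hG : forall g : G, Gplus gamma g.
Variables (r : nat) (deg : 'I_r -> G).
Variables (L : colorLiePAlg p gamma) (x : 'I_r -> L).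
Hypothesis hL : free_on deg x.

Local Notation tree := (@tree _ 'I_r).
Implicit Types (t : tree) (k : nat) (alpha : 'X_{1..r}) (z : L).

Let pp : prime p := pcharf_prime pcharF.
Let hx := free_deg hL.
Let A := free_algebra F r.
Let M := falg_plie pcharF hgamma hG deg A.

(** A morphism from L to the free associative algebra that maps the generators
    to the letters maps a p-power of a standard bracket to the power of its word
    plus greater words. *)
Lemma leads_pev (phi : {linear L -> M}) : color_hom phi ->
  (forall i, phi (x i) = word A [:: i]) ->
  forall t k, std t -> leads (wpow (fw t) (p ^ k)) (phi (pev deg x t k)).
Proof.
move=> hphi phix t k st; elim: k => [|k IH]; last first.
  rewrite /= (hom_pmap hphi (pev_comp hx t k)) expnS -wpow_mul.
  exact: leads_pmap.
rewrite expn0 /wpow /= cats0.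
elim: t st => [i _|a IHa b IHb] /=; first by rewrite phix; apply: leads_word.
move=> /and4P[sa sb ab _]; rewrite (hom_bracket hphi).
apply: leads_bracket (hom_comp hphi (ev_comp hx a)) (hom_comp hphi (ev_comp hx b))
  (IHa sa) (IHb sb) _.
by apply: lyndon_swap => //; apply: std_lyndon.
Qed.

(** A subspace spanned by the p-powers of standard brackets whose words lie in a
    set [S] has these p-powers as a basis: they are linearly independent, their
    images in the free associative algebra having distinct least words. *)
Lemma has_dim_pidx (n : nat) (S : {set n.-tuple 'I_r}) (W : L -> Prop) : (0 < n)%N ->
  (forall t k (v : n.-tuple 'I_r), std t -> v \in S ->
    wpow (fw t) (p ^ k) = v -> W (pev deg x t k)) ->
  (forall z, W z -> lspan (fun z => exists t k (v : n.-tuple 'I_r),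
    [/\ std t, z = pev deg x t k, v \in S & wpow (fw t) (p ^ k) = v]) z) ->
  has_dim W #|pidx p S|.
Proof.
move=> n0 hW Wspan; set d := #|_|.
have ex (i : 'I_d) : exists tk : tree * nat,
    std tk.1 /\ wpow (fw tk.1) (p ^ tk.2) = enum_val i.
  have := enum_valP i; set v := enum_val i; rewrite inE.
  case/and3P=> vS /least_rotP vmin /eqP vN.
  have v0 : (v : seq _) <> [::] by move/(congr1 size)/eqP; rewrite size_tuple -leqn0 leqNgt n0.
  have [t st et] := lyndon_std (least_rotation_lyndon v0 vmin).
  exists (t, logn p (n %/ per v)); split=> //=.
  by rewrite et -vN [RHS]wpow_per size_tuple.
have [f hf] := fin_all_exists ex.
exists (fun i => pev deg x (f i).1 (f i).2); split=> [i|c|z Wz].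
- have [st ef] := hf i; apply: hW st _ ef.
  by have := enum_valP i; rewrite inE => /and3P[].
- have hy i : comp (deg i) (word A [:: i] : M).
    have -> : deg i = wdeg deg [:: i] by rewrite /wdeg big_seq1.
    exact: fcomp_word.
  have [phi hphi phix] := free_lift hL hy.
  move=> /(congr1 phi); rewrite linear_sum linear0 => c0.
  apply: (@leads_free _ _ _ _ _ hgamma hG _ deg A 'I_d (fun i => enum_val i)
    (fun i => phi (pev deg x (f i).1 (f i).2))).
  - by move=> i j /val_inj /enum_val_inj.
  - by move=> i; have [st <-] := hf i; apply: leads_pev.
  - by rewrite -[RHS]c0; apply: eq_bigr => i _; rewrite linearZ.
pose W' z := exists c : 'I_d -> F, z = \sum_i c i *: pev deg x (f i).1 (f i).2.
apply: (lspan_subspace (W := W') _ _ (Wspan z Wz)).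
  split=> [|a u v [c ->] [c' ->]].
    by exists (fun=> 0); rewrite big1 // => i _; rewrite scale0r.
  exists (fun i => a * c i + c' i); rewrite scaler_sumr -big_split.
  by apply: eq_bigr => i _; rewrite scalerDl scalerA.
move=> _ [t [k [v [st -> vS ev]]]].
have lt := std_lyndon st.
have pk0 : (0 < p ^ k)%N by rewrite expn_gt0 prime_gt0.
have szt : (0 < size (fw t))%N by case: lt => /eqP; rewrite -size_eq0 lt0n.
have vD : v \in pidx p S.
  rewrite inE vS /=; apply/andP; split.
    by apply/least_rotP => i; rewrite -ev; apply: lyndon_pow_least.
  have en : (p ^ k * size (fw t))%N = n by rewrite -size_wpow ev size_tuple.
  have -> : (n %/ per v)%N = (p ^ k)%N.
    by rewrite -ev lyndon_per // -[X in (X %/ _)%N]en mulnK.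
  by rewrite pfactorK.
pose i := enum_rank_in vD v.
have [sti efi] := hf i; rewrite enum_rankK_in // -ev in efi.
have pf0 : (0 < p ^ (f i).2)%N by rewrite expn_gt0 prime_gt0.
have [e1 e2] := lyndon_pow_inj (std_lyndon sti) lt pf0 pk0 efi.
exists (fun j => (j == i)%:R); rewrite (bigD1 i) //= eqxx scale1r big1 ?addr0.
  rewrite (fw_inj sti st e1).
  by move/eqP: e2; rewrite eqn_exp2l ?prime_gt1 // => /eqP->.
by move=> j /negPf->; rewrite scale0r.
Qed.

Lemma mdcomp_lspan alpha z : mdcomp x alpha z ->
  lspan (fun z => exists t k, [/\ std t, z = pev deg x t k &
    content (wpow (fw t) (p ^ k)) = alpha]) z.
Proof.
move=> /(mdcomp_pspan pcharF hx); apply: lspan_mono => _ [t [k [st -> e]]].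
by exists t, k; rewrite content_wpow.
Qed.

Lemma has_dim_mdcomp alpha : alpha != 0%MM ->
  has_dim (mdcomp x alpha)
    #|pidx p [set v : (mdeg alpha).-tuple 'I_r | content v == alpha]|.
Proof.
move=> a0; apply: has_dim_pidx; first by rewrite lt0n mdeg_eq0.
  move=> t k v st; rewrite inE => /eqP cv ev; rewrite -cv -ev content_wpow.
  exact: pev_mdcomp.
move=> z /mdcomp_lspan; apply: lspan_mono => _ [t [k [st -> e]]].
have sz : size (wpow (fw t) (p ^ k)) == mdeg alpha by rewrite -mdeg_content e.
by exists t, k, (Tuple sz); split=> //; rewrite inE /= e.
Qed.

Lemma has_dim_totcomp n : (0 < n)%N ->
  has_dim (totcomp x n) #|pidx p [set: n.-tuple 'I_r]|.
Proof.
move=> n0; apply: has_dim_pidx => // [t k v st _ ev|z [u [hu ->]]].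
  set beta := content (wpow (fw t) (p ^ k)).
  have bn : mdeg beta = n by rewrite /beta mdeg_content ev size_tuple.
  have bz : mdcomp x beta (pev deg x t k).
    by rewrite /beta content_wpow; apply: pev_mdcomp.
  exists (fun alpha => if alpha == beta then pev deg x t k else 0); split.
    by move=> alpha; case: eqP => [->|_] //; apply: Mdcomp_0.
  have bb : (mdeg beta < n.+1)%N by rewrite bn.
  rewrite (bigD1 (BMultinom bb)) /= ?bn // eqxx big1 ?addr0 // => alpha /andP[_].
  by rewrite -val_eqE /= => /negPf->.
have [s0 sD _] := subspaceP (subspace_lspan (fun z => exists t k (v : n.-tuple 'I_r),
  [/\ std t, z = pev deg x t k, v \in [set: n.-tuple 'I_r] & wpow (fw t) (p ^ k) = v])).
elim/big_ind: _ => // alpha /eqP an.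
move/mdcomp_lspan: (hu alpha); apply: lspan_mono => _ [t [k [st -> e]]].
have sz : size (wpow (fw t) (p ^ k)) == n by rewrite -mdeg_content e an.
by exists t, k, (Tuple sz); split=> //; rewrite inE.
Qed.

End Dimension.

(** [card_pidx], with rational values. *)
Lemma pidx_formula p n r (S : {set n.-tuple 'I_r}) : prime p -> (0 < n)%N ->
  (forall i v, v \in S -> rott i v \in S) ->
  #|pidx p S|%:R = n%:R^-1 * \sum_(1 <= m < n.+1 | (m %| n)%N)
    (moebius_p p m)%:~R * #|[set v in S | rott (n %/ m) v == v]|%:R :> rat.
Proof.
move=> pp n0 Srot; have nz : n%:R != 0 :> rat by rewrite Num.Theory.pnatr_eq0 -lt0n.
apply: (mulfI nz); rewrite mulrA divff // mul1r.
have := congr1 (fun z : int => z%:~R : rat) (card_pidx n0 pp Srot).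
rewrite rmorphM rmorph_sum /= => ->; apply: eq_bigr => m _; exact: intrM.
Qed.

Theorem corollary2p5p10 (p : nat) (F : fieldType) (hp : p \in [pchar F])
    (G : zmodType) (gamma : G -> G -> F) (hgamma : color_bicharacter gamma)
    (hG : forall g : G, Gplus gamma g)
    (r : nat) (deg : 'I_r -> G) (L : colorLiePAlg p gamma) (x : 'I_r -> L)
    (hL : free_on deg x) :
  (forall n : nat, (0 < n)%N ->
     exists2 d : nat, has_dim (totcomp x n) d &
       d%:R = n%:R^-1 *
         \sum_(1 <= m < n.+1 | (m %| n)%N)
            (moebius_p p m)%:~R * r%:R ^+ (n %/ m) :> rat) /\
  (forall alpha : 'X_{1..r}, alpha != 0%MM ->
     exists2 d : nat, has_dim (mdcomp x alpha) d &
       d%:R = (mdeg alpha)%:R^-1 *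
         \sum_(1 <= m < (mdeg alpha).+1 | [forall i, (m %| alpha i)%N])
            (moebius_p p m)%:~R *
            (((mdeg alpha %/ m)`!)%:R / \prod_(i < r) ((alpha i %/ m)`!)%:R)
         :> rat).
Proof.
have pp := pcharf_prime hp; split=> [n n0|alpha a0].
  exists #|pidx p [set: n.-tuple 'I_r]|; first exact: (has_dim_totcomp hp hgamma hG hL).
  rewrite pidx_formula // => [|i v _]; last exact: in_setT.
  by congr (_ * _); apply: eq_bigr => m mn; rewrite card_fixed_all // natrX.
have n0 : (0 < mdeg alpha)%N by rewrite lt0n mdeg_eq0.
eexists; first exact: (has_dim_mdcomp hp hgamma hG hL).
rewrite pidx_formula // => [|i v]; last first.
  rewrite !inE => /eqP e; rewrite -[X in _ == X]e; apply/eqP/content_perm.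
  by rewrite perm_rot.
congr (_ * _); rewrite big_mkcond [RHS]big_mkcond /=; apply: eq_bigr => m _.
have [mn|mn] := boolP (m %| mdeg alpha)%N; last first.
  rewrite ifN //; apply: contra mn => /forallP ma.
  by rewrite mdegE; apply: dvdn_sum => i _.
have := card_fixed_content n0 mn (erefl (mdeg alpha)).
have P0 : (\prod_(i < r) (alpha i %/ m)`!)%:R != 0 :> rat.
  by rewrite Num.Theory.pnatr_eq0 -lt0n prodn_gt0 // => i; apply: fact_gt0.
move/(congr1 (fun k => k%:R : rat)); rewrite !natrM => e.
case: ifP e => _ /= e; rewrite ?mul1r ?mul0r in e.
  by rewrite -natr_prod -e mulfK.
by move/eqP: e; rewrite mulf_eq0 (negPf P0) orbF => /eqP->; rewrite mulr0.
Qed.
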